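(* If $S$ is an $n$-dimensional Clifford quantum polynomial algebra, then $Z(S)_2=\{g^2\in S_2\mid g\in S_1\}$. In particular, every Clifford quadratic complete intersection $A$ of length $r$ in $n$ variables is of the form $A=S/(g_1^2,\dots,g_r^2)$ where $S$ is an $n$-dimensional Clifford quantum polynomial algebra and $g_1,\dots,g_r\in S_1$.
   Context: $k$ is an algebraically closed field of characteristic $0$; all algebras are over $k$. For graded right modules $M,N$ over a connected graded algebra $S$, $\underline{\mathrm{Ext}}^i_S(M,N)=\bigoplus_{j\in\mathbb Z}\mathrm{Ext}^i_{\mathrm{grmod}\,S}(M,N(j))$; $H_S(t)=\sum_i(\dim_k S_i)t^i$; $Z(S)$ is the center of $S$ and $Z(S)_2$ its degree-$2$ part. A noetherian connected graded algebra $S$ is an $n$-dimensional quantum polynomial algebra if $\mathrm{gldim}\,S=n$, $\underline{\mathrm{Ext}}^i_S(k,S)\cong k(n)$ for $i=n$ and $0$ for $i\neq n$, and $H_S(t)=(1-t)^{-n}$. For a sequence $F=(F_1,\dots,F_n)$ of linearly independent symmetric matrices in $M_n(k)$, the graded Clifford algebra is $$C(F)=k\langle x_1,\dots,x_n,y_1,\dots,y_n\rangle/\Big(x_ix_j+x_jx_i-\sum_{m=1}^n(F_m)_{ij}y_m,\; x_iy_j-y_jx_i,\; y_iy_j-y_jy_i\Big)_{1\le i,j\le n},$$ with $\deg x_i=1$, $\deg y_j=2$. An $n$-dimensional Clifford quantum polynomial algebra is an $n$-dimensional quantum polynomial algebra isomorphic, as a graded algebra, to some $C(F)$. A Clifford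 quadratic complete intersection of length $r$ in $n$ variables is an algebra $S/(f_1,\dots,f_r)$ with $S$ an $n$-dimensional Clifford quantum polynomial algebra and $f_1,\dots,f_r\in Z(S)_2$ a regular sequence (each $f_i$ is a non-zero-divisor in $S/(f_1,\dots,f_{i-1})$). *)

(* Defs.v *)
From HB Require Import structures.
From mathcomp Require Import all_boot all_order all_algebra.
From mathcomp Require Import boolp classical_sets.
From mathcomp Require Import monalg.

Set Implicit Arguments.
Unset Strict Implicit.
Unset Printing Implicit Defensive.

Import GRing.Theory.
Local Open Scope classical_set_scope.
Local Open Scope quotient_scope.
Local Open Scope ring_scope.

(* Right modules over a ring S are left modules over the converse ring S^c. *)
Definition ract (S : pzRingType) (M : lmodType S^c) (v : M) (s : S) : M :=
  (s : S^c) *: v.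

Definition left_ideal (R : pzRingType) (I : set R) : Prop :=
  [/\ I 0, forall a b, I a -> I b -> I (a - b) & forall r a, I a -> I (r * a)].

Definition left_noetherian (R : pzRingType) : Prop :=
  forall I : nat -> set R,
    (forall i, left_ideal (I i)) -> (forall i, I i `<=` I i.+1) ->
    exists N, forall i, (N <= i)%N -> I i = I N.

Definition noetherian (S : pzRingType) : Prop :=
  left_noetherian S /\ left_noetherian S^c.

Definition two_sided_ideal (R : pzRingType) (I : set R) : Prop :=
  left_ideal I /\ forall a r, I a -> I (a * r).

Definition ideal_gen (R : pzRingType) (G : set R) : set R :=
  smallest (@two_sided_ideal R) G.

Lemma ideal_genP (R : pzRingType) (G : set R) : two_sided_ideal (ideal_gen G).
Proof.
split; [split|].
- by move=> J [[[]]].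
- move=> a b Ia Ib J JJ; case: (JJ) => [[[_ JB _] _] _].
  by apply: JB; [apply: Ia|apply: Ib].
- move=> r a Ia J JJ; case: (JJ) => [[[_ _ JM] _] _].
  by apply: JM; apply: Ia.
- move=> a r Ia J JJ; case: (JJ) => [[_ JM] _].
  by apply: JM; apply: Ia.
Qed.

Section QuotientAlgebra.
Variables (k : fieldType) (S : algType k) (G : set S).

Definition ideal_pred : {pred S} := fun s => `[< ideal_gen G s >].

Lemma ideal_predP s : reflect (ideal_gen G s) (s \in ideal_pred).
Proof. exact: asboolP. Qed.

Lemma ideal_pred_zmod_closed : zmod_closed ideal_pred.
Proof.
have [[I0 IB _] _] := ideal_genP G.
split=> [|a b /ideal_predP Ia /ideal_predP Ib]; apply/ideal_predP => //.
exact: IB.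
Qed.

HB.instance Definition _ :=
  GRing.isZmodClosed.Build S ideal_pred ideal_pred_zmod_closed.

(* The quotient algebra S/(G); it is the zero ring when (G) = S, hence it
   only carries a pzRingType structure. *)
Definition quot_alg : Type := Quotient.quot ideal_pred.

HB.instance Definition _ := GRing.Zmodule.on quot_alg.

Definition quot_pi (s : S) : quot_alg := \pi_(Quotient.quot ideal_pred) s.

Lemma quot_piE s t : (quot_pi s = quot_pi t) <-> ideal_gen G (s - t).
Proof.
rewrite /quot_pi; split=> [/eqP|h].
  by rewrite -Quotient.idealrBE => /ideal_predP.
by apply/eqP; rewrite -Quotient.idealrBE; apply/ideal_predP.
Qed.

Lemma quot_pi_repr (q : quot_alg) : quot_pi (repr q) = q.
Proof. exact: reprK. Qed.

Lemma quot_piD s t : quot_pi (s + t) = quot_pi s + quot_pi t.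
Proof. by rewrite /quot_pi !piE. Qed.

Definition quot_mul (p q : quot_alg) : quot_alg := quot_pi (repr p * repr q).
Definition quot_scale (c : k) (q : quot_alg) : quot_alg := quot_pi (c *: repr q).

Lemma quot_repr_pi s : ideal_gen G (repr (quot_pi s) - s).
Proof. by apply/quot_piE; rewrite quot_pi_repr. Qed.

Lemma quot_piM s t : quot_pi (s * t) = quot_mul (quot_pi s) (quot_pi t).
Proof.
have [[I0 IB IM] IMr] := ideal_genP G.
apply/esym/quot_piE.
set s' := repr _; set t' := repr _.
have -> : s' * t' - s * t = s' * (t' - t) - (s - s') * t.
  by rewrite mulrBr mulrBl opprB addrA subrK.
apply: (IB); first by apply: IM; apply: quot_repr_pi.
by apply: IMr; rewrite -opprB -[- _]add0r; apply: IB => //; apply: quot_repr_pi.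
Qed.

Lemma quot_piZ c s : quot_pi (c *: s) = quot_scale c (quot_pi s).
Proof.
have [[I0 IB IM] IMr] := ideal_genP G.
apply/esym/quot_piE; rewrite -scalerBr -mulr_algl.
by apply: IM; apply: quot_repr_pi.
Qed.

Lemma quot_ind (P : quot_alg -> Prop) : (forall s, P (quot_pi s)) -> forall q, P q.
Proof. by move=> h q; rewrite -(quot_pi_repr q). Qed.

Lemma quot_mulA : associative quot_mul.
Proof.
elim/quot_ind=> a; elim/quot_ind=> b; elim/quot_ind=> c.
by rewrite -!quot_piM mulrA.
Qed.

Lemma quot_mul1l : left_id (quot_pi 1) quot_mul.
Proof. by elim/quot_ind=> a; rewrite -quot_piM mul1r. Qed.

Lemma quot_mul1r : right_id (quot_pi 1) quot_mul.
Proof. by elim/quot_ind=> a; rewrite -quot_piM mulr1. Qed.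

Lemma quot_mulDl : left_distributive quot_mul +%R.
Proof.
elim/quot_ind=> a; elim/quot_ind=> b; elim/quot_ind=> c.
by rewrite -!quot_piM -!quot_piD -quot_piM mulrDl.
Qed.

Lemma quot_mulDr : right_distributive quot_mul +%R.
Proof.
elim/quot_ind=> a; elim/quot_ind=> b; elim/quot_ind=> c.
by rewrite -!quot_piM -!quot_piD -quot_piM mulrDr.
Qed.

HB.instance Definition _ := GRing.Zmodule_isPzRing.Build quot_alg
  quot_mulA quot_mul1l quot_mul1r quot_mulDl quot_mulDr.

Lemma quot_scaleA c d q : quot_scale c (quot_scale d q) = quot_scale (c * d) q.
Proof. by elim/quot_ind: q => s; rewrite -!quot_piZ scalerA. Qed.

Lemma quot_scale1 : left_id 1 quot_scale.
Proof. by elim/quot_ind=> s; rewrite -quot_piZ scale1r. Qed.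

Lemma quot_scaleDr : right_distributive quot_scale +%R.
Proof.
move=> c; elim/quot_ind=> s; elim/quot_ind=> t.
by rewrite -!quot_piZ -!quot_piD -quot_piZ scalerDr.
Qed.

Lemma quot_scaleDl q c d :
  quot_scale (c + d) q = quot_scale c q + quot_scale d q.
Proof. by elim/quot_ind: q => s; rewrite -!quot_piZ -quot_piD scalerDl. Qed.

HB.instance Definition _ := GRing.Zmodule_isLmodule.Build k quot_alg
  quot_scaleA quot_scale1 quot_scaleDr quot_scaleDl.

End QuotientAlgebra.

Section Grading.
Variables (I : eqType) (V : zmodType).
Implicit Types (f g : I -> V) (v w : V).

Definition is_fin_sum f v : Prop :=
  exists s : seq I,
    [/\ uniq s, forall i, i \notin s -> f i = 0 & v = \sum_(i <- s) f i].

Definition is_grading (W : I -> set V) : Prop :=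
  [/\ forall i, W i 0,
      forall i u v, W i u -> W i v -> W i (u - v)
    & forall v, exists! f, (forall i, W i (f i)) /\ is_fin_sum f v].

Lemma fin_sum_widen f (s t : seq I) : uniq s -> uniq t -> {subset s <= t} ->
  (forall i, i \notin s -> f i = 0) -> \sum_(i <- s) f i = \sum_(i <- t) f i.
Proof.
move=> us ut st f0; rewrite [RHS](bigID (mem s)) /= [X in _ + X]big1 // addr0.
rewrite -[RHS]big_filter; apply/perm_big/uniq_perm; rewrite ?filter_uniq // => i.
by rewrite mem_filter /=; case: (boolP (i \in s)) => // /st ->.
Qed.

Lemma fin_sumD f g v w : is_fin_sum f v -> is_fin_sum g w ->
  is_fin_sum (fun i => f i + g i) (v + w).
Proof.
move=> [s [us f0 ->]] [t [ut g0 ->]]; exists (undup (s ++ t)).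
split=> [|i|]; first exact: undup_uniq.
  by rewrite mem_undup mem_cat negb_or => /andP[/f0 -> /g0 ->]; rewrite addr0.
rewrite big_split; congr (_ + _); apply: fin_sum_widen => //;
  rewrite ?undup_uniq // => i; rewrite mem_undup mem_cat => ->//.
exact: orbT.
Qed.

Lemma grading_uniq (W : I -> set V) v f g : is_grading W ->
  (forall i, W i (f i)) -> is_fin_sum f v ->
  (forall i, W i (g i)) -> is_fin_sum g v -> f = g.
Proof.
move=> [_ _ /(_ v)[h [_ hu]]] Wf sf Wg sg.
by rewrite -(hu f) // -(hu g).
Qed.

Lemma gradingD (W : I -> set V) i u v : is_grading W ->
  W i u -> W i v -> W i (u + v).
Proof.
move=> [W0 WB _] Wu Wv; rewrite -[v]opprK; apply: (WB) => //.
by rewrite -sub0r; apply: WB.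
Qed.

End Grading.

Definition has_dim (k : fieldType) (V : lmodType k) (W : set V) (d : nat) : Prop :=
  exists b : 'I_d -> V, (forall i, W (b i)) /\
    forall v, W v -> exists! c : {ffun 'I_d -> k}, v = \sum_i c i *: b i.

Record cgAlgebra (k : fieldType) := CgAlgebra {
  cg_sort :> algType k;
  gr : nat -> set cg_sort;
  gr_grading : is_grading gr;
  gr_scale : forall i c s, gr i s -> gr i (c *: s);
  gr_mul : forall i j s t, gr i s -> gr j t -> gr (i + j)%N (s * t);
  gr_conn : gr 0%N = [set c%:A | c in [set: k]]
}.
Arguments gr {k} S _ : rename.

(* S/(G) with the grading induced by [grB] on S *)
Definition quot_gr (k : fieldType) (B : algType k) (grB : nat -> set B)
    (G : set B) (d : nat) : set (quot_alg G) := @quot_pi k B G @` grB d.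

Arguments quot_gr {k B} grB G d.

(* A is isomorphic to B/(G) as a graded algebra *)
Definition gr_iso_quot (k : fieldType) (A : cgAlgebra k)
    (B : algType k) (grB : nat -> set B) (G : set B) : Prop :=
  exists phi : {rmorphism A -> quot_alg G},
    [/\ scalable phi, bijective phi &
        forall d a, gr A d a <-> quot_gr grB G d (phi a)].

(* H_S(t) (1 - t)^n = 1 in Z[[t]] *)
Definition hilbert_series_inv (k : fieldType) (S : cgAlgebra k) (n : nat) : Prop :=
  exists h : nat -> nat, (forall i, has_dim (gr S i) (h i)) /\
    forall i, \sum_(j < i.+1)
      ((1 - 'X) ^+ n : {poly int})`_j * (h (i - j)%N)%:Z = (i == 0%N)%:R.

Section Homological.
Variable R : pzRingType.

Definition surj (A B : Type) (f : A -> B) : Prop := forall y, exists x, f x = y.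

Definition exact_at (A B : Type) (C : zmodType) (f : A -> B) (g : B -> C) : Prop :=
  forall y, g y = 0 <-> exists x, f x = y.

Definition projective (P : lmodType R) : Prop :=
  forall (M N : lmodType R) (p : {linear M -> N}) (f : {linear P -> N}),
    surj p -> exists g : {linear P -> M}, forall x, p (g x) = f x.

Definition pd_le (M : lmodType R) (n : nat) : Prop :=
  exists (P : nat -> lmodType R) (d : forall i, {linear P i.+1 -> P i})
         (e : {linear P 0%N -> M}),
    [/\ forall i, projective (P i),
        forall i, (n < i)%N -> forall x : P i, x = 0,
        surj e, exact_at (d 0%N) e
      & forall i, exact_at (d i.+1) (d i)].

Definition gldim_le (n : nat) : Prop := forall M : lmodType R, pd_le M n.

Definition left_gldim (n : nat) : Prop :=
  gldim_le n /\ forall m, gldim_le m -> (n <= m)%N.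

End Homological.

Definition right_gldim (S : pzRingType) (n : nat) : Prop := left_gldim S^c n.

Section GradedModules.
Variables (k : fieldType) (S : cgAlgebra k).

Record grModule := GrModule {
  gm_sort :> lmodType S^c;
  grm : int -> set gm_sort;
  grm_grading : is_grading grm;
  grm_act : forall i j v s,
    grm i v -> gr S j s -> grm (i + j%:Z) (ract v s)
}.

Section Shift.
Variables (M : grModule) (n : int).

Definition shift_gr (i : int) : set M := grm (i + n).

Lemma shift_grading : is_grading shift_gr.
Proof.
have [W0 WB We] := grm_grading M; split=> [i|i u v|v]; [exact: W0|exact: WB|].
have [f [[Wf [s [us f0 ->]]] fu]] := We v.
exists (fun i => f (i + n)); split.
  split=> [i|]; first exact: Wf.
  exists [seq i - n | i <- s]; split=> [|i|].
  - by rewrite map_inj_uniq // => i j /addIr.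
  - move=> his; apply: f0; apply: contra his => his.
    by apply/mapP; exists (i + n) => //; rewrite addrK.
  - by rewrite big_map; apply: eq_bigr => i _; rewrite subrK.
move=> g [Wg [t [ut g0 gs]]].
have fg : f = (fun i => g (i - n)).
  apply: fu; split=> [i|].
    by have := Wg (i - n); rewrite /shift_gr subrK.
  exists [seq i + n | i <- t]; split=> [|i|].
  - by rewrite map_inj_uniq // => i j /addIr.
  - move=> hit; apply: g0; apply: contra hit => hit.
    by apply/mapP; exists (i - n) => //; rewrite subrK.
  - by rewrite gs big_map; apply: eq_bigr => i _; rewrite addrK.
by apply: funext => i; rewrite fg addrK.
Qed.

Lemma shift_act i j v s :
  shift_gr i v -> gr S j s -> shift_gr (i + j%:Z) (ract v s).
Proof. by move=> vi sj; rewrite /shift_gr addrAC; apply: grm_act. Qed.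

(* M(n), with M(n)_i = M_(n+i) *)
Definition shift : grModule := GrModule shift_grading shift_act.

End Shift.


Section RegularModule.

Definition reg_gr (i : int) : set (S^c)^o :=
  if i is Posz d then gr S d else [set 0].

Lemma reg_grading : is_grading reg_gr.
Proof.
have [W0 WB We] := gr_grading S; split=> [[d|d]|[d|d] u v|v] //=.
- exact: WB.
- by move=> -> ->; rewrite subrr.
have [f [[Wf [s [us f0 ->]]] fu]] := We v.
exists (fun i : int => if i is Posz d then f d else 0); split.
  split=> [[d|d]|] //=; exists (map Posz s); split=> [|[d|d]|] //.
  - by rewrite map_inj_uniq // => i j [].
  - by rewrite mem_map; [exact: f0|move=> i j []].
  - by rewrite big_map.
move=> g [Wg [t [ut g0 gs]]].
have gN d : g (Negz d) = 0 by exact: (Wg (Negz d)).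
have fg : f = g \o Posz.
  apply: fu; split=> [d|]; first exact: (Wg (Posz d)).
  exists (pmap (fun i : int => if i is Posz d then Some d else None) t).
  split=> [|d|].
  - by apply: pmap_uniq (fun d => Posz d) _ _ _ => // -[d|d].
  - move=> hd; apply: g0; apply: contra hd => hd.
    by rewrite mem_pmap; apply/mapP; exists (Posz d).
  - rewrite gs; elim: (t) => [|[d|d] t' IH] /=; rewrite ?big_nil ?big_cons //=.
      by rewrite IH.
    by rewrite gN add0r IH.
by apply: funext => -[d|d]; rewrite ?fg ?gN.
Qed.

Lemma reg_act i j (v : (S^c)^o) s :
  reg_gr i v -> gr S j s -> reg_gr (i + j%:Z) (ract v s).
Proof.
case: i => [d|d] /=; first by move=> vi sj; apply: gr_mul.
have [W0 _ _] := reg_grading; move=> -> _; rewrite /ract scaler0; exact: W0.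
Qed.

(* S as a graded right module over itself *)
Definition reg_module : grModule := GrModule reg_grading reg_act.

End RegularModule.

Section ResidueModule.

(* c is the constant term of s *)
Definition is_aug (s : S) (c : k) : Prop :=
  exists f : nat -> S,
    [/\ forall i, gr S i (f i), is_fin_sum f s & f 0%N = c%:A].

Definition aug (s : S) : k := xget 0 (is_aug s).

Lemma is_aug_uniq s c d : is_aug s c -> is_aug s d -> c = d.
Proof.
move=> [f [Wf sf f0]] [g [Wg sg g0]].
have fg : f = g by exact: grading_uniq (gr_grading S) Wf sf Wg sg.
apply/eqP; rewrite -subr_eq0; apply/eqP.
have : (c - d)%:A = 0 :> S by rewrite scalerBl -f0 -g0 fg subrr.
by move/eqP; rewrite scaler_eq0 oner_eq0 orbF => /eqP.
Qed.

Lemma augP s : is_aug s (aug s).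
Proof.
have [c hc] : exists c, is_aug s c.
  have [_ _ /(_ s)[f [[Wf sf] _]]] := gr_grading S.
  have := Wf 0%N; rewrite gr_conn => -[c _ hc].
  by exists c, f.
by rewrite /aug; case: xgetP => // /(_ c).
Qed.

Lemma augE s c : is_aug s c -> aug s = c.
Proof. exact/is_aug_uniq/augP. Qed.

Lemma gr_sum (J : Type) (r : seq J) d (F : J -> S) :
  (forall j, gr S d (F j)) -> gr S d (\sum_(j <- r) F j).
Proof.
move=> WF; have [W0 _ _] := gr_grading S; elim: r => [|j r IH].
  by rewrite big_nil; exact: W0.
by rewrite big_cons; apply: gradingD (gr_grading S) _ _.
Qed.

Lemma augD s t : aug (s + t) = aug s + aug t.
Proof.
apply: augE; have [f [Wf sf f0]] := augP s; have [g [Wg sg g0]] := augP t.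
exists (fun i => f i + g i); split; first by move=> i; apply: gradingD (gr_grading S) _ _.
  exact: fin_sumD.
by rewrite f0 g0 scalerDl.
Qed.

Lemma aug1 : aug 1 = 1.
Proof.
have [W0 _ _] := gr_grading S.
apply: augE; exists (fun i => if i == 0%N then 1 else 0).
split=> [[|i]|//=|//=]; [|exact: W0| |by rewrite scale1r].
  by rewrite gr_conn /=; exists 1 => //; rewrite scale1r.
exists [:: 0%N]; split=> [//|[|i]//|]; by rewrite big_seq1.
Qed.

Lemma sum_iota N (f : nat -> S) : \sum_(i <- iota 0 N) f i = \sum_(i < N) f i.
Proof. by rewrite -(big_mkord xpredT f) /index_iota subn0. Qed.

Lemma fin_sum_poly (f : nat -> S) s : is_fin_sum f s ->
  exists p : {poly S}, (forall i, p`_i = f i) /\ s = p.[1].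
Proof.
move=> [r [ur f0 ->]].
pose N := (\max_(i <- r) i.+1)%N.
have rN i : i \in r -> (i < N)%N.
  by move=> ir; rewrite /N (big_rem i) //= leq_maxl.
have fN i : (N <= i)%N -> f i = 0.
  by move=> Ni; apply: f0; apply: contraL Ni => /rN; rewrite -ltnNge.
exists (\poly_(i < N) f i); split=> [i|].
  by rewrite coef_poly; case: ltnP => // /fN.
rewrite horner_poly (fin_sum_widen (t := iota 0 N)) ?iota_uniq //.
  by rewrite sum_iota; apply: eq_bigr => i _; rewrite expr1n mulr1.
by move=> i /rN iN; rewrite mem_iota.
Qed.

Lemma poly_fin_sum (p : {poly S}) : is_fin_sum (fun i => p`_i) p.[1].
Proof.
exists (iota 0 (size p)); split=> [|i|]; first exact: iota_uniq.
  by rewrite mem_iota /= add0n -leqNgt => /leq_sizeP ->.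
rewrite horner_coef sum_iota.
by apply: eq_bigr => i _; rewrite expr1n mulr1.
Qed.

Lemma augM s t : aug (s * t) = aug s * aug t.
Proof.
apply: augE; have [f [Wf sf f0]] := augP s; have [g [Wg sg g0]] := augP t.
have [p [pf sp]] := fin_sum_poly sf; have [q [qg tq]] := fin_sum_poly sg.
exists (fun i => (p * q)`_i); split=> [i||].
- rewrite coefM; apply: gr_sum => j; rewrite pf qg.
  by rewrite -[i in gr S i](subnKC (ltnSE (ltn_ord j))); apply: gr_mul.
- have -> : s * t = (p * q).[1].
    by rewrite hornerM_comm ?sp ?tq // /comm_poly mulr1 mul1r.
  exact: poly_fin_sum.
- rewrite coefM big_ord1 /= pf qg f0 g0.
  by rewrite -scalerAl mul1r scalerA.
Qed.

Lemma aug_pos i s : (0 < i)%N -> gr S i s -> aug s = 0.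
Proof.
have [W0 _ _] := gr_grading S.
move=> i0 si; apply: augE; exists (fun j => if j == i then s else 0); split.
- by move=> j; case: eqP => [->|_].
- exists [:: i]; split=> [//|j|]; last by rewrite big_seq1 eqxx.
  by rewrite inE => /negbTE ->.
- by rewrite ifN ?scale0r // neq_ltn i0.
Qed.

(* the carrier of the module k = S/S_(>0), on which S acts through [aug] *)
Definition residue : Type := k.
HB.instance Definition _ := GRing.Zmodule.on residue.

Definition residue_scale (s : S^c) (c : residue) : residue := aug s * c.

Lemma residue_scaleA (s t : S^c) c :
  residue_scale s (residue_scale t c) = residue_scale (s * t) c.
Proof. by rewrite /residue_scale (augM t s) mulrA [aug t * _]mulrC. Qed.

Lemma residue_scale1 : left_id 1 residue_scale.
Proof. by move=> c; rewrite /residue_scale aug1 mul1r. Qed.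

Lemma residue_scaleDr : right_distributive residue_scale +%R.
Proof. by move=> s c d; rewrite /residue_scale mulrDr. Qed.

Lemma residue_scaleDl c (s t : S^c) :
  residue_scale (s + t) c = residue_scale s c + residue_scale t c.
Proof. by rewrite /residue_scale augD mulrDl. Qed.

HB.instance Definition _ := GRing.Zmodule_isLmodule.Build S^c residue
  residue_scaleA residue_scale1 residue_scaleDr residue_scaleDl.

Definition residue_gr (i : int) : set residue :=
  if i == 0 then setT else [set 0].

Lemma residue_grading : is_grading residue_gr.
Proof.
rewrite /residue_gr; split=> [i|i u v|v]; first by case: eqP.
  by case: eqP => // _ -> ->; rewrite subrr.
exists (fun i => if i == 0 then v else 0); split.
  split=> [i|]; first by case: eqP.
  exists [:: 0]; split=> [//|i|]; last by rewrite big_seq1.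
  by rewrite inE => /negbTE ->.
move=> g [Wg [t [ut g0 ->]]].
have gz i : i != 0 -> g i = 0 by move=> /negbTE hi; have := Wg i; rewrite hi.
apply: funext => i; case: eqP => [->|/eqP/gz ->//].
have [z|z] := boolP (0 \in t).
  by rewrite (bigD1_seq 0) //= big1 ?addr0 // => j /gz.
rewrite g0 // big1_seq // => j /andP[_ jt]; apply: gz.
by apply: contraNneq z => <-.
Qed.

Lemma residue_act i j (v : residue) s :
  residue_gr i v -> gr S j s -> residue_gr (i + j%:Z) (ract v s).
Proof.
rewrite /residue_gr /ract; case: (posnP j) => [-> |j0] vi sj.
  by move: vi; rewrite addr0; case: eqP => // _ ->; rewrite scaler0.
have -> : (s : S^c) *: v = 0 by rewrite /GRing.scale /= /residue_scale (aug_pos j0 sj) mul0r.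
by case: eqP.
Qed.

Definition residue_module : grModule := GrModule residue_grading residue_act.

End ResidueModule.

Definition fin_gen (M : grModule) : Prop :=
  exists (m : nat) (g : 'I_m -> M),
    forall v, exists c : 'I_m -> S, v = \sum_i ract (g i) (c i).

Definition grhom (M N : grModule) (f : M -> N) : Prop :=
  forall i v, grm i v -> grm i (f v).

Definition grprojective (P : grModule) : Prop :=
  forall (M N : grModule) (p : {linear M -> N}) (f : {linear P -> N}),
    fin_gen M -> fin_gen N -> grhom p -> grhom f -> surj p ->
    exists g : {linear P -> M}, grhom g /\ forall x, p (g x) = f x.

(* Projective resolutions in the category grmod S of finitely generated graded
   right modules; Ext does not depend on the choice of the resolution. *)
Record grResolution (M : grModule) := GrResolution {
  resP : nat -> grModule;
  resd : forall i, {linear resP i.+1 -> resP i};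
  rese : {linear resP 0%N -> M};
  resP_fg : forall i, fin_gen (resP i);
  resP_proj : forall i, grprojective (resP i);
  resd_hom : forall i, grhom (resd i);
  rese_hom : grhom rese;
  rese_surj : surj rese;
  resd_exact0 : exact_at (resd 0%N) rese;
  resd_exact : forall i, exact_at (resd i.+1) (resd i)
}.

Section Cochains.
Variables (M N : grModule) (R : grResolution M).

Definition cocycle (i : nat) (f : {linear resP R i -> N}) : Prop :=
  grhom f /\ forall x, f (resd R i x) = 0.

Definition coboundary (i : nat) : {linear resP R i -> N} -> Prop :=
  if i is j.+1 then fun f => exists h : {linear resP R j -> N},
    grhom h /\ forall x, f x = h (resd R j x)
  else fun f => forall x, f x = 0.

End Cochains.

(* Ext^i_(grmod S)(M, N) is isomorphic to the k-subspace T of V: phi induces a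
   k-linear bijection from cocycles modulo coboundaries onto T. *)
Definition Ext_iso (i : nat) (M N V : grModule) (T : set V) : Prop :=
  exists (R : grResolution M) (phi : {linear resP R i -> N} -> V),
    [/\ forall f, cocycle f -> T (phi f),
        forall (a : k) f g h, cocycle f -> cocycle g -> cocycle h ->
          (forall x, h x = ract (f x) a%:A + g x) ->
          phi h = ract (phi f) a%:A + phi g,
        forall w, T w -> exists f, cocycle f /\ phi f = w
      & forall f, cocycle f -> (phi f = 0 <-> coboundary f)].

(* The graded k-space with components Ext^i_(grmod S)(M, N(j)) is isomorphic
   to the graded k-space with components T j. *)
Definition uExt_iso (i : nat) (M N V : grModule) (T : int -> set V) : Prop :=
  forall j, Ext_iso i M (shift N j) (T j).

Definition gorenstein_cond (n : nat) : Prop :=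
  uExt_iso n residue_module reg_module (@grm (shift residue_module n%:Z)) /\
  forall i, i <> n ->
    uExt_iso i residue_module reg_module
      (fun _ => [set 0 : residue_module]).

Definition quantum_polynomial (n : nat) : Prop :=
  [/\ noetherian S, right_gldim S n, gorenstein_cond n
    & hilbert_series_inv S n].

(* Z(S)_2 *)
Definition centre2 : set S := [set z | gr S 2 z /\ forall s, z * s = s * z].

End GradedModules.

Section Clifford.
Variables (k : fieldType) (n : nat).

(* the free algebra k<x_1,..,x_n,y_1,..,y_n>; [inl i] is the index of x_i and
   [inr j] that of y_j *)
Definition free_alg : Type := {malg k[{fmonom ('I_n + 'I_n)%type}]}.

HB.instance Definition _ := GRing.Lalgebra.on free_alg.

Lemma free_alg_scaleAr (c : k) (u v : free_alg) : c *: (u * v) = u * (c *: v).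
Proof.
rewrite -!mul_malgC [RHS]mulrA [LHS]mulrA; congr (_ * v).
rewrite mul_malgC [RHS]malgM_def fgmulgU [LHS]malgZ_def.
by apply: eq_bigr => m _; rewrite mulm1 mulrC.
Qed.

HB.instance Definition _ :=
  GRing.Lalgebra_isAlgebra.Build k free_alg free_alg_scaleAr.

Definition fx (i : 'I_n) : free_alg := << fmu (inl i) >>.
Definition fy (i : 'I_n) : free_alg := << fmu (inr i) >>.

Definition word_deg (m : {fmonom ('I_n + 'I_n)%type}) : nat :=
  (\sum_(v <- (m : seq _)) (if v is inl _ then 1 else 2))%N.

Definition free_gr (d : nat) : set free_alg :=
  [set g : free_alg | forall m, mcoeff m g != 0 -> word_deg m = d].

Definition clifford_rel (F : n.-tuple 'M[k]_n) : set free_alg :=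
  [set r | exists i j : 'I_n,
    [\/ r = fx i * fx j + fx j * fx i - \sum_m tnth F m i j *: fy m,
        r = fx i * fy j - fy j * fx i
      | r = fy i * fy j - fy j * fy i]].

Definition is_clifford (S : cgAlgebra k) : Prop :=
  exists F : n.-tuple 'M[k]_n,
    [/\ free F, forall m, (tnth F m)^T = tnth F m
      & gr_iso_quot S free_gr (clifford_rel F)].

Definition clifford_qpa (S : cgAlgebra k) : Prop :=
  quantum_polynomial S n /\ is_clifford S.

End Clifford.

Definition non_zero_divisor (R : pzRingType) (a : R) : Prop :=
  GRing.lreg a /\ GRing.rreg a.

Definition regular_seq (k : fieldType) (S : algType k) (r : nat)
    (f : 'I_r -> S) : Prop :=
  forall i : 'I_r,
    non_zero_divisor (quot_pi [set f j | j in [set j : 'I_r | (j < i)%N]] (f i)).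

Definition clifford_qci (k : fieldType) (n r : nat) (A : cgAlgebra k) : Prop :=
  exists (S : cgAlgebra k) (f : 'I_r -> S),
    [/\ clifford_qpa n S, forall i, centre2 (f i), regular_seq f
      & gr_iso_quot A (gr S) (range f)].

(* Main.v *)
(* C(F) is a free module over its central subalgebra k[y_1, .., y_n]: the ordered
   monomials in the x's and y's span it and are as many as its Hilbert series
   (1 - t)^(-n) requires, in any basis of linear forms.  Hence a central element
   z = sum C_ij x_i x_j + sum b_m y_m satisfies (C - C^T) F_m = 0 for all m.

   A linear form g = sum v_i x_i has g^2 = 1/2 sum_m (v F_m v^T) y_m.  If v <> 0 is
   a common zero of the forms F_m, then g^2 = 0 and the right annihilator of g is gS,
   so S/gS has a periodic resolution and infinite projective dimension.  Thus the F_m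
   have no common zero.  This forces C = C^T, so that z is in the span of the y's,
   and it makes v |-> (v F_m v^T)_m surjective onto k^n, so that z is a square.

   Surjectivity reduces to the existence of a nontrivial common zero of m < n
   quadratic forms q_l in n variables.  By counting dimensions, some z_i has no power
   in the ideal (q); the homomorphism sending all q_l / z_i^2 to 0 then extends to
   a k-valued place of k(z_1, .., z_n), and dividing the z's by one of largest
   valuation gives the common zero. *)

From HB Require Import structures.
Require Import Defs.
From mathcomp Require Import all_boot all_order all_algebra.
From mathcomp Require Import boolp classical_sets.
From mathcomp Require Import monalg mpoly ring.

Set Implicit Arguments.
Unset Strict Implicit.
Unset Printing Implicit Defensive.

Import GRing.Theory.
Local Open Scope classical_set_scope.
Local Open Scope ring_scope.

(** * Subrings of a commutative ring given as sets *)

Section SubringSet.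
Variable R : comNzRingType.

Definition subring_set (G : set R) : Prop :=
  [/\ G 1, forall a b, G a -> G b -> G (a - b) & forall a b, G a -> G b -> G (a * b)].

Variables (G : set R) (hG : subring_set G).

Definition set_pred : {pred R} := fun a => `[< G a >].

Lemma set_pred_subring_closed : subring_closed set_pred.
Proof.
case: hG => G1 GB GM; split; first exact/asboolP.
  by move=> a b /asboolP Ga /asboolP Gb; apply/asboolP/GB.
by move=> a b /asboolP Ga /asboolP Gb; apply/asboolP/GM.
Qed.

Definition adjoin_set (w : R) : set R :=
  [set u | exists2 p, p \is a polyOver set_pred & u = p.[w]].

End SubringSet.

Section SubringSetTheory.
Variables (R : comNzRingType) (G : set R) (hG : subring_set G).

HB.instance Definition _ :=
  GRing.isSubringClosed.Build R (set_pred G) (set_pred_subring_closed hG).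

Lemma adjoin_subring w : subring_set (adjoin_set G w).
Proof.
split.
- by exists 1; rewrite ?rpred1 // hornerC.
- by move=> _ _ [p pG ->] [q qG ->]; exists (p - q); rewrite ?rpredB // !hornerE.
- by move=> _ _ [p pG ->] [q qG ->]; exists (p * q); rewrite ?rpredM // !hornerE.
Qed.

Lemma sub_adjoin w : G `<=` adjoin_set G w.
Proof.
by move=> a Ga; exists a%:P; rewrite ?hornerC // polyOverC; apply/asboolP.
Qed.

Lemma mem_adjoin w : adjoin_set G w w.
Proof. by exists 'X; rewrite ?hornerX ?polyOverX. Qed.

Lemma subring_set0 : G 0. Proof. by apply/asboolP; exact: (rpred0 (set_pred G)). Qed.

Lemma subring_setD a b : G a -> G b -> G (a + b).
Proof.
by move=> /asboolP Ga /asboolP Gb; apply/asboolP; exact: (rpredD (Ga : a \in set_pred G)).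
Qed.

Lemma subring_setX a i : G a -> G (a ^+ i).
Proof.
case: hG => G1 _ GM Ga; elim: i => [|i IH]; rewrite ?expr0 // exprS; exact: GM.
Qed.

Lemma subring_set_sum (I : Type) (r : seq I) (P : pred I) (F : I -> R) :
  (forall i, P i -> G (F i)) -> G (\sum_(i <- r | P i) F i).
Proof.
move=> h; elim/big_rec: _ => [|i x Pi Gx]; first exact: subring_set0.
by apply: subring_setD => //; apply: h.
Qed.

Lemma polyOver_setB p q : p \is a polyOver (set_pred G) ->
  q \is a polyOver (set_pred G) -> p - q \is a polyOver (set_pred G).
Proof. by move=> pG qG; rewrite rpredB. Qed.

Lemma polyOver_setM p q : p \is a polyOver (set_pred G) ->
  q \is a polyOver (set_pred G) -> p * q \is a polyOver (set_pred G).
Proof. by move=> pG qG; rewrite rpredM. Qed.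

Lemma polyOver_setZ a p : G a ->
  p \is a polyOver (set_pred G) -> a *: p \is a polyOver (set_pred G).
Proof. by move=> /asboolP Ga pG; rewrite polyOverZ. Qed.

(** For invertible [w] the sum is [w ^+ N] times the value of [p] at the inverse of [w], by
    [horner_rev]; this clears denominators. *)
Lemma adjoin_homog w p N : G w -> p \is a polyOver (set_pred G) -> (size p <= N.+1)%N ->
  G (\sum_(i < N.+1) p`_i * w ^+ (N - i)).
Proof.
move=> Gw /polyOverP pG pN; apply: subring_set_sum => i _.
by case: hG => _ _ GM; apply: GM; [apply/asboolP/pG|apply: subring_setX].
Qed.

End SubringSetTheory.

(** * Extending a partial homomorphism to a [k]-valued place *)

(* A [k]-algebra homomorphism from a [k]-subalgebra of [L] to [k] is encoded by
   its graph: a [k]-subalgebra of [L * k] that does not contain [(0, 1)]. *)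
Section Place.
Variables (k : closedFieldType) (L : fieldType) (iota : {rmorphism k -> L}).
Implicit Types (G T : set (L * k)%type).

Definition partial_hom G : Prop :=
  [/\ subring_set G, forall c, G (iota c, c) & ~ G (0, 1)].

Section Extension.
Variable T : set (L * k)%type.
Hypothesis hT : partial_hom T.

Lemma maximal_partial_hom : exists G,
  [/\ partial_hom G, T `<=` G
    & forall G', partial_hom G' -> G `<=` G' -> G' `<=` G].
Proof.
pose P G := G = set0 \/ (partial_hom G /\ T `<=` G).
have [|G [PG Gmax]] := @Zorn_bigcup _ P.
  move=> F FP tot.
  have [[X FX X0]|noX] := pselect (exists2 X, F X & X != set0); last first.
    left; rewrite -subset0 => a [X FX Xa]; exfalso; apply: noX.
    by exists X => //; apply/set0P; exists a.
  have good Y : F Y -> Y !=set0 -> partial_hom Y /\ T `<=` Y.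
    by move=> FY [y Yy]; case: (FP _ FY) => // Y0; move: Yy; rewrite Y0.
  have [[[X1 XB XM] Xi X01] TX] := good X FX (proj1 (set0P X) X0).
  right; split; last by move=> a /TX Xa; exists X.
  have join a b : (\bigcup_(Y in F) Y) a -> (\bigcup_(Y in F) Y) b ->
      exists Y, [/\ F Y, Y a & Y b].
    move=> [Y FY Ya] [Z FZ Zb].
    by case: (tot Y Z FY FZ) => h; [exists Z|exists Y]; split=> //; apply: h.
  split; first split; first by exists X.
  - move=> a b ha hb; have [Y [FY Ya Yb]] := join a b ha hb.
    have [[[_ YB _] _ _] _] := good Y FY (ex_intro _ a Ya).
    by exists Y => //; apply: YB.
  - move=> a b ha hb; have [Y [FY Ya Yb]] := join a b ha hb.
    have [[[_ _ YM] _ _] _] := good Y FY (ex_intro _ a Ya).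
    by exists Y => //; apply: YM.
  - by move=> c; exists X.
  - move=> [Y FY Y01]; have [[_ _ ]] := good Y FY (ex_intro _ _ Y01).
    by move=> /(_ Y01).
have [T1 _ _] := hT.
have {}PG : partial_hom G /\ T `<=` G.
  case: PG => // G0; exfalso; apply: (Gmax T); last by right; split=> // a.
  by rewrite G0; split=> // /(_ 1); apply; case: T1.
exists G; case: PG => hG TG; split=> // G' hG' GG' a G'a.
apply: contrapT => Ga; apply: (Gmax G').
  by split=> // h; apply: Ga; apply: h.
by right; split=> // b /TG /GG'.
Qed.

End Extension.

Variable G : set (L * k)%type.
Hypotheses (hG : partial_hom G).
Hypothesis Gmax : forall G', partial_hom G' -> G `<=` G' -> G' `<=` G.

Let Gs : subring_set G. Proof. by case: hG. Qed.
Let GM a b : G a -> G b -> G (a * b). Proof. by case: Gs => _ _; apply. Qed.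
Let Gi c : G (iota c, c). Proof. by case: hG. Qed.

Lemma pairM (a b : L) (c d : k) : (a, c) * (b, d) = (a * b, c * d) :> (L * k)%type.
Proof. by []. Qed.

(** Scaling [(0, c)] by the inverse of [c] would produce [(0, 1)]. Since differences stay in [G],
    this makes [G] the graph of a function. *)
Lemma place_fun c : G (0, c) -> c = 0.
Proof.
move=> Gc; apply/eqP; apply: contrapT => /negP c0.
case: hG => _ _; apply.
have -> : (0, 1) = (iota c^-1, c^-1) * (0, c) :> (L * k)%type.
  by rewrite pairM mulr0 mulVf //; apply/eqP.
exact: GM.
Qed.

Lemma adjoin_place w : G w \/
  exists2 p, p \is a polyOver (set_pred G) & p.[w] = (0, 1).
Proof.
have [h|h] := pselect (adjoin_set G w (0, 1)).
  by right; case: h => p pG e; exists p.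
left; apply: (Gmax (G' := adjoin_set G w)).
- split=> //; first exact: adjoin_subring.
  by move=> c; apply: sub_adjoin.
- exact: sub_adjoin.
- exact: mem_adjoin.
Qed.

Lemma horner_rev (R : comNzRingType) (p : {poly R}) (u v : R) N :
  u * v = 1 -> (size p <= N.+1)%N ->
  p.[u] * v ^+ N = \sum_(i < N.+1) p`_i * v ^+ (N - i).
Proof.
move=> uv pN; rewrite (horner_coef_wide _ pN) mulr_suml; apply: eq_bigr => i _.
rewrite -mulrA; congr (_ * _).
by rewrite -[in v ^+ N](subnKC (ltnSE (ltn_ord i))) exprD mulrA -exprMn uv expr1n mul1r.
Qed.

Lemma pairX (a : L) (c : k) i : (a, c) ^+ i = (a ^+ i, c ^+ i) :> (L * k)%type.
Proof. by elim: i => // i IH; rewrite !exprS IH. Qed.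

(** The domain of a maximal [G] is local. If [(s^-1, c^-1)] could not be added, some polynomial over
    [G] would take the value [(0, 1)] there; clearing denominators puts a pair [(0, c ^+ N)] in [G],
    against [place_fun]. *)
Lemma place_local s c : G (s, c) -> c != 0 -> G (s^-1, c^-1).
Proof.
move=> Gsc c0.
have s0 : s != 0 by apply: contraNneq c0 => s0; apply/eqP/place_fun; rewrite -s0.
have [//|[p pG pw]] := adjoin_place (s^-1, c^-1).
have := adjoin_homog Gs Gsc pG (leqnSn _).
rewrite -(@horner_rev _ _ (s^-1, c^-1)) ?pw //; last first.
  by rewrite pairM !mulVf.
rewrite pairX pairM mul0r mul1r => /place_fun/eqP.
by rewrite expf_eq0 (negbTE c0) andbF.
Qed.

Definition place_ker (x : L) : Prop := G (x, 0).

(** A relation [1 = m_0 + m_1 x + ... + m_d x^d] over the maximal ideal, as in the classical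
    construction of valuation rings. *)
Definition ker_rel (x : L) d : Prop := exists p : {poly L},
  [/\ (size p <= d.+1)%N, forall i, place_ker p`_i & p.[x] = 1].

Lemma map_fst_horner (p : {poly (L * k)%type}) w :
  (p.[w]).1 = (map_poly fst p).[w.1] /\ (p.[w]).2 = (map_poly snd p).[w.2].
Proof. by split; [rewrite (horner_map fst)|rewrite (horner_map snd)]. Qed.

(** If [x] has no value, adjoining [(x, c)] fails for every [c]. So the ideal [I] of [k[t]], formed
    by the reductions of the polynomials over [G] that vanish at [x], has no common zero. As [k] is
    algebraically closed, [I] contains a nonzero constant. *)
Lemma place_fin_or_rel x : (exists c, G (x, c)) \/ exists d, ker_rel x d.
Proof.
have [h|h] := pselect (exists c, G (x, c)); first by left.
right.
pose I (q : {poly k}) := exists p : {poly (L * k)%type},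
  [/\ p \is a polyOver (set_pred G), map_poly snd p = q & (map_poly fst p).[x] = 0].
have Inz c : exists2 q, I q & q.[c] = 1.
  have [Gc|[p pG pw]] := adjoin_place (x, c); first by case: h; exists c.
  have [e1 e2] := map_fst_horner p (x, c); rewrite pw /= in e1 e2.
  by exists (map_poly snd p); [exists p|].
pose m := fun s => `[< exists q, [/\ I q, q != 0 & size q = s] >].
have [s ms] : exists s, m s.
  have [q Iq q0] := Inz 0; exists (size q); apply/asboolP; exists q; split=> //.
  by apply: contra_eqN q0 => /eqP ->; rewrite horner0 eq_sym oner_eq0.
have [{ms}s /asboolP[q [Iq q0 qs]] smin] := ex_minnP (ex_intro m s ms).
have [s1|s1] := boolP (size q != 1%N); last first.
  have {s1} /size_poly1P[c c0 qc] : size q == 1%N by rewrite -[_ == _]negbK.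
  case: Iq => p [pG p2 p1].
  (* After scaling, [r] vanishes at [x] and reduces to 1, so [1 - r] has its coefficients in the
     maximal ideal and value 1 at [x]. *)
  pose r := (iota c^-1, c^-1) *: p.
  have rG : r \is a polyOver (set_pred G).
    exact: (polyOver_setZ Gs (Gi _) pG).
  have r1i i : (map_poly fst r)`_i = iota c^-1 * (p`_i).1 by rewrite coef_map coefZ.
  have r2 i : (r`_i).2 = (i == 0%N)%:R.
    rewrite coefZ /= -(coef_map snd) p2 qc coefC.
    by case: (i == 0%N); rewrite ?mulr0 ?mulVf.
  have r1 : (map_poly fst r).[x] = 0.
    have -> : map_poly fst r = iota c^-1 *: map_poly fst p.
      by apply/polyP => i; rewrite r1i coefZ coef_map.
    by rewrite hornerZ p1 mulr0.
  exists (size r); exists (1 - map_poly fst r); split.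
  - rewrite (leq_trans (size_polyD _ _)) // size_polyN geq_max size_poly1 /=.
    by rewrite (leq_trans (size_poly _ _)).
  - move=> i; rewrite /place_ker coefB coef1 coef_map.
    have := Gs => -[_ GB _].
    have -> : ((i == 0%N)%:R - (r`_i).1, 0) =
       ((i == 0%N)%:R : (L * k)%type) - r`_i.
      have := r2 i; case: (r`_i) => a1 a2 /= ->; case: (i == 0%N).
        by rewrite -[RHS]/(1 - a1, 1 - 1) subrr.
      by rewrite -[RHS]/(0 - a1, 0 - 0) subrr.
    apply: GB; last by apply/asboolP; exact: (polyOverP rG).
    by case: (i == 0%N); [case: Gs|apply: subring_set0].
  - by rewrite !hornerE r1 subr0.
(* A nonconstant [q] has a root [c]. By minimality of its size it divides every member of [I], among
   them some [q'] with [q'.[c] = 1]. *)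
have /closed_rootP[c qc] := s1.
have [q' [p' [pG' p2' p1']] q'c] := Inz c.
case: Iq => p [pG p2 p1].
pose d := q' %/ q.
pose D := map_poly (fun a => (iota a, a)) d.
have DG : D \is a polyOver (set_pred G).
  apply/polyOverP => i; rewrite coef_map_id0 ?rmorph0 //.
  exact/asboolP/Gi.
have D2 : map_poly snd D = d.
  by apply/polyP => i; rewrite coef_map /= coef_map_id0 ?rmorph0.
have Ir : I (q' %% q).
  exists (p' - D * p); split; first exact: (polyOver_setB Gs pG' (polyOver_setM Gs DG pG)).
    rewrite rmorphB rmorphM /= D2 p2' p2; apply/eqP.
    by rewrite subr_eq addrC -divp_eq.
  by rewrite rmorphB rmorphM /= hornerD hornerN hornerM p1 p1' mulr0 subr0.
have r0 : q' %% q = 0.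
  apply/eqP; apply: contrapT => /negP r0.
  have /smin : m (size (q' %% q)) by apply/asboolP; exists (q' %% q).
  by rewrite -qs leqNgt ltn_modp q0.
move: q'c; rewrite (divp_eq q' q) r0 addr0 hornerM (rootP qc) mulr0.
by move/esym/eqP; rewrite oner_eq0.
Qed.

Lemma place_kerM a b c : place_ker a -> G (b, c) -> place_ker (a * b).
Proof. by move=> Ga Gb; have := GM Ga Gb; rewrite pairM mul0r. Qed.

Lemma place_kerD a b : place_ker a -> place_ker b -> place_ker (a + b).
Proof.
move=> Ga Gb; have := subring_setD Gs Ga Gb.
by rewrite -[_ + _]/(a + b, 0 + 0) addr0.
Qed.

Lemma place_ker0 : place_ker 0. Proof. exact: (subring_set0 Gs). Qed.

Lemma place_unit a : place_ker a -> a != 1 /\ G ((1 - a)^-1, 1).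
Proof.
move=> Ga; have h : G (1 - a, 1).
  have -> : (1 - a, 1) = 1 - (a, 0) :> (L * k)%type.
    by rewrite -[RHS]/(1 - a, 1 - 0) subr0.
  by case: (Gs) => G1 GB _; apply: GB.
split; last by rewrite -[X in (_, X)]invr1; apply: place_local (oner_neq0 _).
apply/eqP => a1; case: hG => _ _; apply.
by rewrite a1 subrr in h.
Qed.

(** Multiplying the relation for the inverse of [x] by [x ^+ d.+1] expresses [(1 - m_0) x ^+ d.+1]
    through lower powers, as [e <= d.+1]. By [place_unit] the factor [1 - m_0] is invertible, so the
    top term of the relation for [x] can be replaced. *)
Lemma ker_rel_reduce x d e : x != 0 -> (e <= d.+1)%N ->
  ker_rel x d.+1 -> ker_rel x^-1 e -> ker_rel x d.
Proof.
move=> x0 ed [p [ps pk px]] [m [ms mk mx]].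
have [m1 Gu] := place_unit (mk 0%N); set u := (1 - m`_0)^-1 in Gu.
have m1' : 1 - m`_0 != 0 by rewrite subr_eq0 eq_sym.
have key : \sum_(j < d.+1) m`_(d.+1 - j) * x ^+ j = x ^+ d.+1 * (1 - m`_0).
  have h := @horner_rev _ m x^-1 x d.+1 (mulVf x0) (leq_trans ms (ed : e < d.+2)%N).
  rewrite mx mul1r big_ord_recl /= subn0 in h.
  rewrite mulrBr mulr1 {1}h addrAC [m`_0 * _]mulrC subrr add0r.
  rewrite (reindex_inj rev_ord_inj) /=; apply: eq_bigr => j _.
  by rewrite /bump /= add1n (@subKn j.+1 d.+1).
exists (\poly_(j < d.+1) (p`_j + p`_d.+1 * (u * m`_(d.+1 - j)))); split.
- exact: size_poly.
- move=> i; rewrite coef_poly; case: ifP => _; last exact: place_ker0.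
  apply: place_kerD => //; apply: place_kerM (pk _) (GM Gu (mk _)).
- rewrite horner_poly -px [RHS](horner_coef_wide _ ps) [RHS]big_ord_recr /=.
  under eq_bigr do rewrite mulrDl.
  rewrite big_split /=; congr (_ + _).
  under eq_bigr do rewrite -!mulrA.
  by rewrite -!mulr_sumr key /u [x ^+ _ * _]mulrC (mulrA _^-1) mulVf // mul1r.
Qed.

Lemma ker_rel0 x : ~ ker_rel x 0.
Proof.
move=> [p [/size1_polyC -> pk]]; rewrite hornerC => p0.
by have [] := place_unit (pk 0%N); rewrite coefC eqxx p0 eqxx.
Qed.

(** Descent on [d + e]: exchanging [x] and its inverse allows [e <= d], and then [d] can be lowered
    until [ker_rel0] applies. *)
Lemma ker_rel_contra x d e : x != 0 -> ker_rel x d -> ker_rel x^-1 e -> False.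
Proof.
have [N] := ubnP (d + e); elim: N x d e => // N IH x d e deN x0 hd he.
wlog ed : x d e x0 hd he deN / (e <= d)%N.
  move=> H; case: (leqP e d) => ed; first exact: (H x d e).
  apply: (H x^-1 e d); rewrite ?invr_eq0 ?invrK 1?addnC //; exact: ltnW.
case: d ed hd deN => [|d] ed hd deN; first exact: (ker_rel0 hd).
apply: (IH x d e) => //; exact: ker_rel_reduce he.
Qed.

(** The domain of [G] is thus a valuation ring of [L]. *)
Lemma place_total x : x != 0 -> (exists c, G (x, c)) \/ (exists c, G (x^-1, c)).
Proof.
move=> x0; have [|[d hd]] := place_fin_or_rel x; first by left.
have [|[e he]] := place_fin_or_rel x^-1; first by right.
by case: (ker_rel_contra x0 hd he).
Qed.

End Place.

(** * Linear algebra: spanning families and dimension *)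

Section Covering.
Variable k : fieldType.

Definition linear_set (V : lmodType k) (W : set V) : Prop :=
  W 0 /\ forall a u v, W u -> W v -> W (a *: u + v).

Definition spanned_by (V : lmodType k) d (b : 'I_d -> V) (W : set V) : Prop :=
  forall v, W v -> exists c : 'I_d -> k, v = \sum_i c i *: b i.

(** An upper bound for the dimension. The spanning family may lie outside [W], so the bound passes
    to subsets. *)
Definition covered (V : lmodType k) (W : set V) (d : nat) : Prop :=
  exists b : 'I_d -> V, spanned_by b W.

Definition lin_indep (V : lmodType k) d (b : 'I_d -> V) : Prop :=
  forall c : 'I_d -> k, \sum_i c i *: b i = 0 -> forall i, c i = 0.

Variable V : lmodType k.
Implicit Types W : set V.

Lemma linear_setD W u v : linear_set W -> W u -> W v -> W (u + v).
Proof. by move=> [_ WL] Wu Wv; rewrite -[u]scale1r; apply: WL. Qed.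

Lemma linear_setZ W a u : linear_set W -> W u -> W (a *: u).
Proof. by move=> [W0 WL] Wu; rewrite -[_ *: _]addr0; apply: WL. Qed.

Lemma linear_setN W u : linear_set W -> W u -> W (- u).
Proof. by move=> hW Wu; rewrite -scaleN1r; apply: linear_setZ. Qed.

Lemma linear_set_sum W (I : Type) (r : seq I) (P : pred I) (F : I -> V) :
  linear_set W -> (forall i, P i -> W (F i)) -> W (\sum_(i <- r | P i) F i).
Proof.
move=> hW h; elim/big_rec: _ => [|i x Pi Wx]; first by case: hW.
by apply: linear_setD => //; apply: h.
Qed.

Definition cat_family (U : Type) d e (b : 'I_d -> U) (b' : 'I_e -> U) (i : 'I_(d + e)) : U :=
  match split i with inl j => b j | inr j => b' j end.

Lemma sum_cat_family d e (b : 'I_d -> V) (b' : 'I_e -> V) (c : 'I_d -> k) (c' : 'I_e -> k) :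
  \sum_i cat_family c c' i *: cat_family b b' i = \sum_i c i *: b i + \sum_i c' i *: b' i.
Proof.
rewrite big_split_ord /=; congr (_ + _); apply: eq_bigr => i _;
  rewrite /cat_family; case: splitP => j //=.
- by move=> /val_inj ->.
- by move=> /= ij; have := ltn_ord i; rewrite ij ltnNge leq_addr.
- by move=> /= ij; have := ltn_ord j; rewrite -ij ltnNge leq_addr.
- by move=> /addnI/val_inj ->.
Qed.

Lemma sum_mulmx m d e (u : 'M[k]_(m, d)) (M : 'M[k]_(d, e)) (b : 'I_e -> V) r :
  \sum_i u r i *: \sum_j M i j *: b j = \sum_j (u *m M) r j *: b j.
Proof.
under eq_bigr do rewrite scaler_sumr.
rewrite exchange_big /=; apply: eq_bigr => j _.
by rewrite mxE scaler_suml; apply: eq_bigr => i _; rewrite scalerA.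
Qed.

Lemma spanned_mx d e (b : 'I_d -> V) (b' : 'I_e -> V) W :
  (forall i, W (b i)) -> spanned_by b' W ->
  exists M : 'M[k]_(d, e), forall i, b i = \sum_j M i j *: b' j.
Proof.
move=> bW hb'.
have /choice[m hm] : forall i, exists c : 'I_e -> k, b i = \sum_j c j *: b' j.
  by move=> i; apply: hb'.
exists (\matrix_(i, j) m i j) => i; rewrite hm.
by apply: eq_bigr => j _; rewrite mxE.
Qed.

Lemma lin_indep_row_free d e (b : 'I_d -> V) (b' : 'I_e -> V) (M : 'M[k]_(d, e)) :
  lin_indep b -> (forall i, b i = \sum_j M i j *: b' j) -> row_free M.
Proof.
move=> bfree hM; rewrite -kermx_eq0; apply/eqP/row_matrixP => i; rewrite row0.
have : row i (kermx M) *m M = 0 by rewrite -row_mul mulmx_ker row0.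
move: (row i _) => u uM; apply/rowP => j; rewrite mxE; apply: (bfree (u 0)).
under eq_bigr do rewrite hM.
by rewrite sum_mulmx uM big1 // => l _; rewrite mxE scale0r.
Qed.

Lemma lin_indep_leq d e (b : 'I_d -> V) W :
  lin_indep b -> (forall i, W (b i)) -> covered W e -> (d <= e)%N.
Proof.
move=> bfree bW [b' /(spanned_mx bW)[M hM]].
by rewrite -(eqP (lin_indep_row_free bfree hM)) rank_leq_col.
Qed.

Lemma has_dim_lin_indep W d : has_dim W d ->
  exists b : 'I_d -> V, [/\ lin_indep b, forall i, W (b i) & spanned_by b W].
Proof.
move=> [b [bW bu]]; exists b; split=> // [c c0 i|v /bu[c [e _]]]; last first.
  by exists c.
(* The null combination [c] is added to the unit coordinates [w i] of [b i]; uniqueness of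
   coordinates then gives [c = 0]. *)
pose w i := [ffun j : 'I_d => (j == i)%:R : k].
have bi j : b j = \sum_l w j l *: b l.
  rewrite (bigD1 j) //= big1 => [|l /negbTE lj]; rewrite ffunE ?eqxx ?lj ?scale1r ?addr0 //.
  by rewrite scale0r.
have [f [_ fu]] := bu _ (bW i).
have e1 := fu _ (bi i).
have /fu : b i = \sum_l (w i + finfun c) l *: b l.
  transitivity (\sum_l w i l *: b l + \sum_l c l *: b l).
    by rewrite c0 addr0 -bi.
  by rewrite -big_split /=; apply: eq_bigr => l _; rewrite [in RHS]ffunE scalerDl [finfun c l]ffunE.
rewrite e1 => /ffunP/(_ i); rewrite !ffunE => /eqP.
by rewrite -subr_eq0 opprD addrA subrr sub0r oppr_eq0 => /eqP.
Qed.

(** The matrix [M] expressing a basis through [b] is square and row free, hence invertible, so a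
    relation among the [b] becomes one among the basis. *)
Lemma has_dim_spanned_free W d (b : 'I_d -> V) :
  has_dim W d -> spanned_by b W -> lin_indep b.
Proof.
move=> /has_dim_lin_indep[e [efree eW _]] hb.
have [M hM] := spanned_mx eW hb.
have Mu : M \in unitmx by rewrite -row_free_unit (lin_indep_row_free efree hM).
have be i : b i = \sum_j invmx M i j *: e j.
  under eq_bigr do rewrite hM.
  rewrite sum_mulmx mulVmx // (bigD1 i) //= mxE eqxx scale1r big1 ?addr0 // => j ji.
  by rewrite mxE eq_sym (negbTE ji) scale0r.
move=> c; pose u := \row_j c j.
have -> : \sum_i c i *: b i = \sum_j (u *m invmx M) 0 j *: e j.
  by rewrite -sum_mulmx; apply: eq_bigr => i _; rewrite mxE be.
move=> /efree uM i; have : u = 0.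
  rewrite -[u]mulmx1 -(mulVmx Mu) mulmxA; suff -> : u *m invmx M = 0 by rewrite mul0mx.
  by apply/rowP => j; rewrite uM mxE.
by move/rowP/(_ i); rewrite !mxE.
Qed.

End Covering.

(** * Normal forms built by adjoining one generator at a time *)

Section AdjoinGenerators.
Variables (k : fieldType) (A : algType k).
Implicit Types (W : nat -> set A) (x y z : A).

Lemma spanned_cat d e (b : 'I_d -> A) (b' : 'I_e -> A) (W W' : set A) x :
  spanned_by b W -> spanned_by b' W' ->
  spanned_by (cat_family b (fun i => x * b' i))
    [set v | exists w u, [/\ W w, W' u & v = w + x * u]].
Proof.
move=> hb hb' v [w [u [/hb[c ->] /hb'[c' ->] ->]]].
exists (cat_family c c'); rewrite sum_cat_family mulr_sumr; congr (_ + _).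
by apply: eq_bigr => i _; rewrite scalerAr.
Qed.

(** Degree [d] part of [W + x W], for [x] of degree 1: [x] occurs at most once and stands on the
    left. *)
Definition adj_linear W x d : set A :=
  if d is d'.+1 then [set v | exists w u, [/\ W d w, W d' u & v = w + x * u]]
  else W d.

(** Degree [d] part of [W + y W + y^2 W + ...], for [y] of degree 2. *)
Fixpoint adj_poly W y d : set A :=
  if d is d'.+2 then [set v | exists w u, [/\ W d w, adj_poly W y d' u & v = w + y * u]]
  else W d.

Definition adj_linears W (xs : seq A) := foldr (fun x W => adj_linear W x) W xs.
Definition adj_polys W (ys : seq A) := foldr (fun y W => adj_poly W y) W ys.

Definition linear_fam W := forall d, linear_set (W d).

Lemma linear_setDM (W W' : set A) x : linear_set W -> linear_set W' ->
  linear_set [set v | exists w u, [/\ W w, W' u & v = w + x * u]].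
Proof.
move=> hW hW'; split; first by exists 0, 0; rewrite mulr0 addr0; case: hW; case: hW'.
move=> a _ _ [w [u [Ww Wu ->]]] [w' [u' [Ww' Wu' ->]]].
exists (a *: w + w'), (a *: u + u'); split; [by case: hW => _; apply|by case: hW' => _; apply|].
by rewrite scalerDr mulrDr scalerAr addrACA.
Qed.

Lemma adj_linear_lin W x : linear_fam W -> linear_fam (adj_linear W x).
Proof. by move=> hW [|d]; [exact: hW|exact: linear_setDM]. Qed.

Lemma adj_poly_lin W y : linear_fam W -> linear_fam (adj_poly W y).
Proof.
move=> hW d; have [N] := ubnP d; elim: N d => // N IH [|[|d]] dN; try exact: hW.
by apply: (linear_setDM y (hW _) (IH d _)); rewrite -ltnS ltnW.
Qed.

Lemma sub_adj_linear W x d v : linear_fam W -> W d v -> adj_linear W x d v.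
Proof.
case: d => // d hW Wv; exists v, 0; split=> //; last by rewrite mulr0 addr0.
by case: (hW d).
Qed.

Lemma sub_adj_poly W y d v : linear_fam W -> W d v -> adj_poly W y d v.
Proof.
case: d => [|[|d]] // hW Wv; exists v, 0; split=> //; last by rewrite mulr0 addr0.
by case: (adj_poly_lin y hW d).
Qed.

Lemma adj_linearM W x d v : linear_fam W -> W d v -> adj_linear W x d.+1 (x * v).
Proof. by move=> hW Wv; exists 0, v; split; rewrite ?add0r //; case: (hW d.+1). Qed.

Lemma adj_polyM W y d v :
  linear_fam W -> adj_poly W y d v -> adj_poly W y d.+2 (y * v).
Proof. by move=> hW Wv; exists 0, v; split; rewrite ?add0r //; case: (hW d.+2). Qed.

Definition maps_deg W z e := forall d v, W d v -> W (e + d)%N (z * v).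

Lemma adj_poly_maps W y z e : linear_fam W -> z * y = y * z ->
  maps_deg W z e -> maps_deg (adj_poly W y) z e.
Proof.
move=> hW zy hz d; have [N] := ubnP d; elim: N d => // N IH d dN v.
case: d dN => [|[|d]] dN; try by move=> /hz/(sub_adj_poly y hW).
move=> [w [u [Ww Wu ->]]]; rewrite mulrDr mulrA zy -mulrA.
apply: linear_setD; first exact: adj_poly_lin.
  exact/sub_adj_poly/hz.
by rewrite !addnS; apply: adj_polyM => //; apply: IH => //; rewrite -ltnS ltnW.
Qed.

Lemma adj_linear_maps W x z e : linear_fam W -> z * x = x * z ->
  maps_deg W z e -> maps_deg (adj_linear W x) z e.
Proof.
move=> hW zx hz [|d] v; first by move=> /hz/(sub_adj_linear x hW).
move=> [w [u [Ww Wu ->]]]; rewrite mulrDr mulrA zx -mulrA.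
apply: linear_setD; first exact: adj_linear_lin.
  exact/sub_adj_linear/hz.
by rewrite addnS; apply: adj_linearM => //; apply: hz.
Qed.

Lemma adj_polys_lin W ys : linear_fam W -> linear_fam (adj_polys W ys).
Proof. by move=> hW; elim: ys => // y ys IH; apply: adj_poly_lin. Qed.

Lemma adj_linears_lin W xs : linear_fam W -> linear_fam (adj_linears W xs).
Proof. by move=> hW; elim: xs => // x xs IH; apply: adj_linear_lin. Qed.

Lemma sub_adj_polys W ys d v : linear_fam W -> W d v -> adj_polys W ys d v.
Proof.
move=> hW Wv; elim: ys => // y ys IH; apply: sub_adj_poly => //; exact: adj_polys_lin.
Qed.

Lemma sub_adj_linears W xs d v : linear_fam W -> W d v -> adj_linears W xs d v.
Proof.
move=> hW Wv; elim: xs => // x xs IH; apply: sub_adj_linear => //; exact: adj_linears_lin.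
Qed.

Lemma adj_polys_maps W ys y : linear_fam W ->
  {in ys &, forall a b : A, a * b = b * a} -> y \in ys -> maps_deg (adj_polys W ys) y 2.
Proof.
move=> hW; elim: ys => // z ys IH zys; rewrite inE => /predU1P[->|yys].
  by move=> d v /(adj_polyM (adj_polys_lin _ hW)).
apply: adj_poly_maps; first exact: adj_polys_lin.
  by apply: zys; rewrite inE ?eqxx ?yys ?orbT.
by apply: IH => // a b ha hb; apply: zys; rewrite inE ?ha ?hb orbT.
Qed.

Lemma adj_linears_maps_comm W xs z e : linear_fam W -> {in xs, forall x, z * x = x * z} ->
  maps_deg W z e -> maps_deg (adj_linears W xs) z e.
Proof.
move=> hW; elim: xs => // x xs IH zxs hz; apply: adj_linear_maps.
- exact: adj_linears_lin.
- by apply: zxs; rewrite inE eqxx.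
- by apply: IH => // y hy; apply: zxs; rewrite inE hy orbT.
Qed.

(* Moving [x] to its place in a normal form only produces anticommutators,
   which [W] absorbs. *)
Lemma adj_linears_maps W xs x : linear_fam W ->
  {in xs &, forall a b, maps_deg W (a * b + b * a) 2 /\
     forall c, c \in xs -> (a * b + b * a) * c = c * (a * b + b * a)} ->
  {in xs, forall a, maps_deg W (a * a) 2 /\
     forall c, c \in xs -> a * a * c = c * (a * a)} ->
  x \in xs -> maps_deg (adj_linears W xs) x 1.
Proof.
move=> hW; elim: xs => // z xs IH hac hsq.
have xsub c : c \in xs -> c \in z :: xs by rewrite inE orbC => ->.
have zin : z \in z :: xs by rewrite inE eqxx.
have hL := adj_linears_lin xs hW.
rewrite inE => /predU1P[->|xxs].
  have [hz hzc] := hsq z zin.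
  have hz2 : maps_deg (adj_linears W xs) (z * z) 2.
    by apply: adj_linears_maps_comm => // c cxs; apply/hzc/xsub.
  move=> [|d] v; first exact: (adj_linearM z hL).
  move=> [w [u [Ww Wu ->]]]; rewrite mulrDr mulrA.
  apply: linear_setD; first exact: adj_linear_lin.
    exact: (adj_linearM z hL Ww).
  exact: (sub_adj_linear z hL (hz2 _ _ Wu)).
have {}IH : maps_deg (adj_linears W xs) x 1.
  apply: IH => // [a b ha hb|a ha].
    have [h h'] := hac a b (xsub _ ha) (xsub _ hb).
    by split=> // c hc; apply/h'/xsub.
  have [h h'] := hsq a (xsub _ ha).
  by split=> // c hc; apply/h'/xsub.
have [hz hzc] := hac x z (xsub _ xxs) zin.
have hz2 : maps_deg (adj_linears W xs) (x * z + z * x) 2.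
  by apply: adj_linears_maps_comm => // c cxs; apply/hzc/xsub.
move=> [|d] v; first by move=> /IH/(sub_adj_linear z hL).
move=> [w [u [Ww Wu ->]]].
have -> : x * (w + z * u) = x * w + ((x * z + z * x) * u + z * (- (x * u))).
  by rewrite mulrDr mulrDl -!mulrA mulrN -addrA subrr addr0.
apply: linear_setD; first exact: adj_linear_lin.
  exact/sub_adj_linear/IH.
apply: linear_setD; first exact: adj_linear_lin.
  exact: (sub_adj_linear z hL (hz2 _ _ Wu)).
apply: adj_linearM => //; apply: linear_setN => //; exact: IH.
Qed.

(** On generating functions this multiplies by [1 + t], while [count_poly] divides by [1 - t^2]. *)
Definition count_linear (f : nat -> nat) d := if d is d'.+1 then (f d + f d')%N else f d.
Fixpoint count_poly (f : nat -> nat) d : nat :=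
  if d is d'.+2 then (f d + count_poly f d')%N else f d.

Definition covered_fam W f := forall d, covered (W d) (f d).

Lemma adj_linear_covered W x f :
  covered_fam W f -> covered_fam (adj_linear W x) (count_linear f).
Proof.
move=> hW [|d]; first exact: hW.
have [b hb] := hW d.+1; have [b' hb'] := hW d.
by exists (cat_family b (fun i => x * b' i)); apply: spanned_cat.
Qed.

Lemma adj_poly_covered W y f :
  covered_fam W f -> covered_fam (adj_poly W y) (count_poly f).
Proof.
move=> hW d; have [N] := ubnP d; elim: N d => // N IH [|[|d]] dN; try exact: hW.
have [b hb] := hW d.+2; have [|b' hb'] := IH d; first by rewrite -ltnS ltnW.
by exists (cat_family b (fun i => y * b' i)); apply: spanned_cat.
Qed.

Lemma adj_polys_covered W ys f :
  covered_fam W f -> covered_fam (adj_polys W ys) (iter (size ys) count_poly f).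
Proof. by move=> hW; elim: ys => //= y ys; apply: adj_poly_covered. Qed.

Lemma adj_linears_covered W xs f :
  covered_fam W f -> covered_fam (adj_linears W xs) (iter (size xs) count_linear f).
Proof. by move=> hW; elim: xs => //= x xs; apply: adj_linear_covered. Qed.

End AdjoinGenerators.

(** * Ideals generated by quadratic forms and their growth *)

Definition qform (k : fieldType) n (F : 'M[k]_n) (v : 'I_n -> k) : k :=
  \sum_i \sum_j F i j * (v i * v j).

Section QuadraticIdeal.
Variables (k : fieldType) (n m : nat).
Local Notation K := {mpoly k[n]}.
Implicit Types (f p : K).

Lemma msizeM_bound f p a b : (msize f <= a.+1)%N -> (msize p <= b.+1)%N ->
  (msize (f * p) <= (a + b).+1)%N.
Proof.
move=> fa pb; have [->|f0] := eqVneq f 0; first by rewrite mul0r msize0.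
have [->|p0] := eqVneq p 0; first by rewrite mulr0 msize0.
rewrite msizeM // -addnS; case: (msize f) fa => [|s] sa; last first.
  by rewrite addSn /= leq_add.
by rewrite add0n (leq_trans (leq_pred _)) // (leq_trans pb) // leq_addl.
Qed.

Lemma msizeX_bound i N : (msize ('X_i ^+ N : K) <= N.+1)%N.
Proof. by rewrite mpolyXn msizeX mdegMn mdeg1 mul1n. Qed.

Definition mquad (F : 'M[k]_n) : K := \sum_i \sum_j F i j *: ('X_i * 'X_j).

Variable q : 'I_m -> K.

(* The elements of the ideal (q) that are of degree at most [N] when the q's
   have degree 2, with a bound on the degrees of the cofactors. *)
Definition ideal_le N f : Prop :=
  exists2 a : 'I_m -> K, f = \sum_l q l * a l & forall l, (msize (a l) <= N.-1)%N.

Lemma ideal_leM N M f p : ideal_le N f -> (msize p <= M.+1)%N -> ideal_le (N + M) (f * p).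
Proof.
move=> [a -> ha] pM; exists (fun l => a l * p).
  by rewrite mulr_suml; apply: eq_bigr => l _; rewrite mulrA.
(* As [msize] is the degree plus one, [N.-1] bounds the degree of the cofactors by [N - 2]; for
   [N < 2] the cofactors vanish. *)
move=> l; have := ha l; case: N {ha} => [|[|N]] /=.
- by rewrite leqn0 mmeasure_poly_eq0 => /eqP ->; rewrite mul0r msize0.
- by rewrite leqn0 mmeasure_poly_eq0 => /eqP ->; rewrite mul0r msize0.
- by move=> aN; rewrite addSn /=; apply: msizeM_bound.
Qed.

Lemma ideal_le_lin N a f p : ideal_le N f -> ideal_le N p -> ideal_le N (a *: f + p).
Proof.
move=> [b -> hb] [c -> hc]; exists (fun l => a *: b l + c l).
  by rewrite scaler_sumr -big_split; apply: eq_bigr => l _; rewrite mulrDr scalerAr.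
move=> l; rewrite (leq_trans (msizeD_le _ _)) // geq_max hc andbT.
exact: leq_trans (msizeZ_le _ _) (hb l).
Qed.

Hypothesis qdeg : forall l, (msize (q l) <= 3)%N.

Lemma ideal_le_size N f : ideal_le N f -> (msize f <= N.+1)%N.
Proof.
move=> [a -> ha]; rewrite (leq_trans (msize_sum _ _ _)) //.
apply/bigmax_leqP => l _; have := ha l; case: N {ha} => [|[|N]] /=.
- by rewrite leqn0 mmeasure_poly_eq0 => /eqP ->; rewrite mulr0 msize0.
- by rewrite leqn0 mmeasure_poly_eq0 => /eqP ->; rewrite mulr0 msize0.
- by move=> aN; apply: (@msizeM_bound _ _ 2 N).
Qed.

End QuadraticIdeal.

Section Growth.
Variables (k : fieldType) (n m : nat).
Local Notation K := {mpoly k[n]}.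
Variables (q : 'I_m -> K) (N : 'I_n -> nat).
Hypothesis hN : forall i, ideal_le q (N i) ('X_i ^+ N i).

Let A := (\max_i N i)%N.

Definition box_mon B (a : {ffun 'I_n -> 'I_B}) : 'X_{1..n} := [multinom (a i : nat) | i < n].

Lemma box_mon_inj B : injective (@box_mon B).
Proof.
move=> a b /mnmP ab; apply/ffunP => i; apply: val_inj.
by have := ab i; rewrite !mnmE.
Qed.

(** The same space for every [d]; it is written as a family only to serve as the base of
    [adj_polys]. *)
Definition box_span (d : nat) : set K :=
  [set f | exists c : {ffun 'I_n -> 'I_A} -> k, f = \sum_a c a *: 'X_[box_mon a]].

Lemma box_span_lin : linear_fam box_span.
Proof.
move=> d; split; first by exists (fun _ => 0); rewrite big1 // => a _; rewrite scale0r.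
move=> x _ _ [b ->] [c ->]; exists (fun a => x * b a + c a).
by rewrite scaler_sumr -big_split; apply: eq_bigr => a _; rewrite scalerDl scalerA.
Qed.

Lemma box_span_covered : covered_fam box_span (fun _ => A ^ n)%N.
Proof.
move=> d; have -> : (A ^ n = #|{ffun 'I_n -> 'I_A}|)%N by rewrite card_ffun !card_ord.
exists (fun i => 'X_[box_mon (enum_val i)]) => f [c ->].
exists (fun i => c (enum_val i)).
rewrite (reindex (fun i : 'I_#|{ffun 'I_n -> 'I_A}| => enum_val i)) //.
exact/onW_bij/enum_val_bij.
Qed.

Let E := adj_polys box_span [seq q l | l <- enum 'I_m].

(** A monomial outside the box is divisible by some ['X_i ^+ N i], which is a combination of the
    [q l] with cofactors of degree at most [N i - 2]. It thus becomes a combination of the [q l]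
    with cofactors of degree at most [D - 2], to which induction applies. *)
Lemma low_degree_span D f : (msize f <= D.+1)%N -> E D f.
Proof.
have hE := adj_polys_lin [seq q l | l <- enum 'I_m] box_span_lin.
have [M] := ubnP D; elim: M D f => // M IH D f DM fD.
rewrite (mpolyE f) big_seq; apply: linear_set_sum => // mn /msize_mdeg_lt mf.
apply: linear_setZ => //.
have {mf fD} mD : (mdeg mn <= D)%N by rewrite -ltnS (leq_trans mf).
have [/forallP small|] := boolP [forall i, mn i < A]%N.
  apply: sub_adj_polys; first exact: box_span_lin.
  pose a : {ffun 'I_n -> 'I_A} := [ffun i => Ordinal (small i)].
  exists (fun b => (b == a)%:R); rewrite (bigD1 a) //= eqxx scale1r big1 ?addr0.
    by congr 'X_[_]; apply/mnmP => i; rewrite mnmE ffunE.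
  by move=> b /negbTE ->; rewrite scale0r.
rewrite negb_forall => /existsP[i]; rewrite -leqNgt => Ami.
have Nm : (N i <= mn i)%N by apply: leq_trans Ami; apply: leq_bigmax.
pose m' := (mn - U_(i) *+ N i)%MM.
have mnE : (mn = U_(i) *+ N i + m')%MM.
  rewrite addmC submK //; apply/mnm_lepP => j; rewrite mulmnE mnm1E.
  by case: eqP => [<-|]; rewrite ?mul1n ?mul0n.
have dm' : (N i + mdeg m' <= D)%N.
  by move: mD; rewrite mnE mdegD mdegMn mdeg1 mul1n.
have [a aE ha] := hN i.
rewrite mnE mpolyXD -mpolyXn aE mulr_suml; apply: linear_set_sum => // l _.
have := ha l; case NE: (N i) dm' => [|[|N']] dm' /=.
- rewrite leqn0 mmeasure_poly_eq0 => /eqP ->; rewrite mulr0 mul0r; by case: (hE D).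
- rewrite leqn0 mmeasure_poly_eq0 => /eqP ->; rewrite mulr0 mul0r; by case: (hE D).
move=> aN; case: D dm' DM {mD} => [|[|D]] // dm' DM.
rewrite -mulrA; apply: (adj_polys_maps box_span_lin) => //.
- by move=> x y _ _; rewrite mulrC.
- by apply: map_f; rewrite mem_enum.
apply: IH; first by rewrite -ltnS ltnW.
apply: leq_trans (msizeM_bound aN (_ : (_ <= (mdeg m').+1)%N)) _.
  by rewrite msizeX.
by rewrite ltnS.
Qed.

Lemma leq_exp2r_w a b e : (a <= b)%N -> (a ^ e <= b ^ e)%N.
Proof. by case: e => // e ab; rewrite leq_exp2r. Qed.

Lemma count_poly_bound f C D : (forall d, d <= D -> f d <= C)%N ->
  (count_poly f D <= C * D.+1)%N.
Proof.
have [M] := ubnP D; elim: M D => // M IH [|[|D]] DM hf /=.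
- by rewrite muln1 hf.
- by rewrite (leq_trans (hf _ _)) // leq_pmulr.
rewrite mulnS leq_add ?hf // (leq_trans (IH D _ _)) //.
- by rewrite -ltnS ltnW.
- by move=> d dD; apply: hf; rewrite (leq_trans dD) // -addn2 leq_addr.
- by rewrite leq_mul2l ltnS leqnSn orbT.
Qed.

Lemma iter_count_poly_bound r j D :
  (iter j count_poly (fun _ => r) D <= r * D.+1 ^ j)%N.
Proof.
elim: j D => [|j IH] D /=; first by rewrite expn0 muln1.
rewrite expnSr mulnA; apply: count_poly_bound => d dD.
by rewrite (leq_trans (IH d)) // leq_mul2l leq_exp2r_w // orbT.
Qed.

(* Every polynomial of degree at most D is a combination of the q-monomials
   of exponents at most D with coefficients in a fixed finite-dimensional space;
   for m < n there are too few of these for the box of all D ^ n monomials. *)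
Lemma growth : (n <= m)%N.
Proof.
rewrite leqNgt; apply/negP => mn.
(* This [B] gives [r ((n + 1) B)^m < B^(m + 1) <= B^n], while the box monomials have degree at most
   [n B]. *)
pose r := (A ^ n)%N; pose B := (r * n.+1 ^ m).+1.
pose b (i : 'I_#|{ffun 'I_n -> 'I_B}|) : K := 'X_[box_mon (enum_val i)].
have bfree : lin_indep b.
  move=> c c0 i; have := congr1 (mcoeff (box_mon (enum_val i))) c0.
  rewrite linear_sum mcoeff0 (bigD1 i) //= mcoeffZ mcoeffX eqxx mulr1 big1 ?addr0 //.
  move=> j ji; rewrite mcoeffZ mcoeffX (inj_eq (@box_mon_inj _)) (inj_eq enum_val_inj).
  by rewrite (negbTE ji) mulr0.
have bE i : E (n * B) (b i).
  apply: low_degree_span; rewrite msizeX ltnS mdegE.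
  have h : (\sum_j box_mon (enum_val i) j <= \sum_(j < n) B)%N.
    by apply: leq_sum => j _; rewrite mnmE ltnW.
  by rewrite (leq_trans h) // sum_nat_const card_ord.
have := lin_indep_leq bfree bE (adj_polys_covered _ box_span_covered _).
rewrite size_map size_enum_ord card_ffun !card_ord => le1.
have /(leq_trans le1) := iter_count_poly_bound r m (n * B).
rewrite leqNgt => /negP; apply.
apply: (@leq_ltn_trans (r * (n.+1 * B) ^ m)).
  by rewrite leq_mul2l leq_exp2r_w ?orbT // mulSn addnC -addn1 leq_add2l.
have /(leq_trans _) : (B ^ m.+1 <= B ^ n)%N by apply: leq_pexp2l.
by apply; rewrite expnMn mulnA expnS ltn_pmul2r ?expn_gt0.
Qed.

End Growth.

(** * Common zeros of fewer quadratic forms than variables *)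

Lemma divf_chart_change (L : fieldType) (a b c : L) : b != 0 -> c != 0 ->
  a / b ^+ 2 * (b / c * (b / c)) = a / c ^+ 2.
Proof. by move=> b0 c0; field; rewrite b0 c0. Qed.

Section CommonZero.
Variables (k : closedFieldType) (n m : nat) (F : 'I_m -> 'M[k]_n).
Local Notation K := {mpoly k[n]}.
Local Notation L := {fraction (mpoly n k)}.

Let q l : K := mquad (F l).

Definition const_frac : {rmorphism k -> L} := @tofrac (mpoly n k) \o @mpolyC n k.

Let z i : L := tofrac ('X_i : K).

Lemma var_frac_neq0 i : z i != 0.
Proof. by rewrite tofrac_eq0 -msize_poly_eq0 msizeX. Qed.

Lemma mquad_frac (G : 'M[k]_n) :
  tofrac (mquad G) = \sum_i \sum_j const_frac (G i j) * (z i * z j).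
Proof.
rewrite /mquad rmorph_sum; apply: eq_bigr => i _; rewrite rmorph_sum.
by apply: eq_bigr => j _; rewrite -mul_mpolyC !rmorphM.
Qed.

Lemma mquad_size G : (msize (mquad G : K) <= 3)%N.
Proof.
rewrite (leq_trans (msize_sum _ _ _)) //; apply/bigmax_leqP => i _.
rewrite (leq_trans (msize_sum _ _ _)) //; apply/bigmax_leqP => j _.
by rewrite (leq_trans (msizeZ_le _ _)) // -mpolyXD msizeX mdegD !mdeg1.
Qed.

Section Chart.
Variable i : 'I_n.
Hypothesis hi : forall N, ~ ideal_le q N ('X_i ^+ N).

(** The graph of [c + p / z_i ^+ N |-> c], where [p] runs over the ideal in degrees at most [N].
    Every [q_l / z_i^2] is in its domain, with value 0. *)
Definition chart_hom : set (L * k)%type :=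
  [set w | exists N p, ideal_le q N p /\ z i ^+ N * (w.1 - const_frac w.2) = tofrac p].

Lemma chart_homP N p c : ideal_le q N p ->
  chart_hom (const_frac c + tofrac p / z i ^+ N, c).
Proof.
move=> hp; exists N, p; split=> //=.
rewrite [const_frac c + _]addrC addrK mulrC divfK //.
by rewrite expf_neq0 // var_frac_neq0.
Qed.

(** Products stay in the graph because [p * r] keeps its degree bound. If [(0, 1)] were in it, some
    ['X_i ^+ N] would lie in the ideal, against [hi]. *)
Lemma chart_hom_partial : partial_hom const_frac chart_hom.
Proof.
have qd l : (msize (q l) <= 3)%N by exact: mquad_size.
have ideal0 N : ideal_le q N 0.
  exists (fun _ => 0) => [|l]; last by rewrite msize0.
  by rewrite big1 // => l _; rewrite mulr0.
have diag c : chart_hom (const_frac c, c).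
  by exists 0%N, 0; split=> //=; rewrite subrr mulr0 rmorph0.
have zX N : z i ^+ N = tofrac ('X_i ^+ N : K) by rewrite rmorphXn.
split=> //.
- split.
  + by have := diag 1; rewrite rmorph1.
  + move=> [a c] [b d] [N [p [hp ep]]] [M [r [hr er]]].
    have {}ep : z i ^+ N * (a - const_frac c) = tofrac p := ep.
    have {}er : z i ^+ M * (b - const_frac d) = tofrac r := er.
    exists (N + M)%N, ('X_i ^+ M * p - 'X_i ^+ N * r); split.
      rewrite addrC -scaleN1r; apply: ideal_le_lin.
        by rewrite addnC mulrC; apply: ideal_leM (msizeX_bound _ _ _).
      by rewrite mulrC; apply: ideal_leM (msizeX_bound _ _ _).
    rewrite -[(_ - _).1]/(a - b) -[(_ - _).2]/(c - d) (rmorphB const_frac).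
    by rewrite tofracB !tofracM -!zX -ep -er exprD; ring.
  + move=> [a c] [b d] [N [p [hp ep]]] [M [r [hr er]]].
    have {}ep : z i ^+ N * (a - const_frac c) = tofrac p := ep.
    have {}er : z i ^+ M * (b - const_frac d) = tofrac r := er.
    exists (N + M)%N, (d *: ('X_i ^+ M * p) + (c *: ('X_i ^+ N * r) + p * r)); split.
      apply: ideal_le_lin; first by rewrite mulrC; apply: ideal_leM (msizeX_bound _ _ _).
      apply: ideal_le_lin; last exact: ideal_leM (ideal_le_size qd hr).
      by rewrite addnC mulrC; apply: ideal_leM (msizeX_bound _ _ _).
    rewrite -[(_ * _).1]/(a * b) -[(_ * _).2]/(c * d) (rmorphM const_frac).
    rewrite -!mul_mpolyC !tofracD !tofracM -!zX -ep -er exprD.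
    by rewrite -[tofrac (mpolyC _ d)]/(const_frac d) -[tofrac (mpolyC _ c)]/(const_frac c); ring.
- move=> [N [p [hp /=]]]; rewrite rmorph1 sub0r mulrN mulr1 zX -rmorphN => /eqP.
  rewrite tofrac_eq => /eqP e; apply: (hi (N := N)).
  rewrite -[_ ^+ N]opprK e -scaleN1r -[_ *: _]addr0; exact: ideal_le_lin.
Qed.

Lemma chart_zero : exists2 v : 'I_n -> k, (exists j, v j != 0) & forall l, qform (F l) v = 0.
Proof.
have [G [hG TG Gmax]] := maximal_partial_hom chart_hom_partial.
have [[G1 GB GM] Gc G01] := hG.
have Gs : subring_set G by case: hG.
(* Of [z a / z b] and its inverse one lies in the valuation ring, so for some [j] all ratios
   [z l / z j] do. Their values [v l] form the zero, with [v j = 1]. *)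
have tot a b : (exists c, G (z a / z b, c)) \/ (exists c, G (z b / z a, c)).
  have := place_total hG Gmax (_ : z a / z b != 0).
  rewrite invf_div; apply.
  by rewrite mulf_neq0 ?invr_eq0 ?var_frac_neq0.
have trans a b d : (exists c, G (z a / z b, c)) -> (exists c, G (z b / z d, c)) ->
    exists c, G (z a / z d, c).
  move=> [c hc] [c' hc']; exists (c * c').
  have := GM _ _ hc hc'; rewrite pairM.
  by rewrite mulrA divfK ?var_frac_neq0.
have refl a : exists c, G (z a / z a, c).
  by exists 1; rewrite divff ?var_frac_neq0.
have max s : s != [::] -> exists j, forall l, l \in s -> exists c, G (z l / z j, c).
  elim: s => // a [|b s] IH _; first by exists a => l; rewrite inE => /eqP ->.
  have [j hj] := IH isT; case: (tot a j) => h.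
    by exists j => l; rewrite inE => /predU1P[->|/hj].
  by exists a => l; rewrite inE => /predU1P[->|/hj/trans]; [exact: refl|apply].
have [j hj] : exists j, forall l, exists c, G (z l / z j, c).
  have [|j hj] := max (enum 'I_n); last by exists j => l; apply: hj; rewrite mem_enum.
  by apply/eqP => /(congr1 (fun s => i \in s)); rewrite mem_enum.
have /choice[v hv] := hj; exists v.
  exists j; have := hv j; rewrite divff ?var_frac_neq0 // => h1.
  suff -> : v j = 1 by rewrite oner_neq0.
  apply/eqP; rewrite -subr_eq0; apply/eqP/(place_fun hG).
  have := GB _ _ h1 G1; by rewrite -[_ - _]/(1 - 1, v j - 1) subrr.
move=> l.
(* The place gives [q_l / z_j^2] the value of the form at [v], and also the value 0, since this is
   [q_l / z_i^2] times the square of [z i / z j]. *)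
have h1 : G (tofrac (q l) / z j ^+ 2, qform (F l) v).
  have -> : (tofrac (q l) / z j ^+ 2, qform (F l) v) =
    \sum_a \sum_b (const_frac (F l a b), F l a b) * ((z a / z j, v a) * (z b / z j, v b)).
    rewrite mquad_frac /qform.
    have key (I : finType) (f : I -> L) (g : I -> k) :
        \sum_a (f a, g a) = (\sum_a f a, \sum_a g a) :> (L * k)%type.
      by elim/big_rec3: _ => // a x y w _ ->.
    under [RHS]eq_bigr do (under eq_bigr do rewrite !pairM; rewrite key).
    rewrite key mulr_suml; congr (_, _); apply: eq_bigr => a _.
    rewrite mulr_suml; apply: eq_bigr => b _.
    by rewrite expr2 invfM -!mulrA; congr (_ * (_ * _)); rewrite mulrCA.
  do 2 (apply: (subring_set_sum Gs) => ? _); apply: (GM) => //; exact: (GM).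
have h2 : G (tofrac (q l) / z j ^+ 2, 0).
  have hq : ideal_le q 2 (q l).
    exists (fun l' => (l' == l)%:R) => [|l'].
      by rewrite (bigD1 l) //= eqxx mulr1 big1 ?addr0 // => l' /negbTE ->; rewrite mulr0.
    by case: eqP => _; rewrite ?msize0 ?msize1.
  have := TG _ (chart_homP 0 hq); rewrite rmorph0 add0r => h.
  have := GM _ _ h (GM _ _ (hv i) (hv i)); rewrite !pairM mul0r.
  by rewrite divf_chart_change ?var_frac_neq0.
have := GB _ _ h1 h2.
by rewrite -[_ - _]/(_ - _, qform (F l) v - 0) subrr subr0 => /(place_fun hG).
Qed.

End Chart.

Lemma common_zero : (m < n)%N ->
  exists2 v : 'I_n -> k, (exists j, v j != 0) & forall l, qform (F l) v = 0.
Proof.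
move=> mn; have [[i hi]|h] := pselect (exists i, forall N, ~ ideal_le q N ('X_i ^+ N)).
  exact: chart_zero hi.
have /choice[N hN] : forall i, exists N, ideal_le q N ('X_i ^+ N).
  by move=> i; apply: contrapT => /forallNP hi; apply: h; exists i.
by have := growth hN; rewrite leqNgt mn.
Qed.

End CommonZero.

Lemma qformZ (k : fieldType) n (F : 'M[k]_n) a v :
  qform F (fun i => a * v i) = a ^+ 2 * qform F v.
Proof.
rewrite /qform mulr_sumr; apply: eq_bigr => i _; rewrite mulr_sumr.
by apply: eq_bigr => j _; ring.
Qed.

Lemma qformB (k : fieldType) n (F G : 'M[k]_n) a v :
  qform (F - a *: G) v = qform F v - a * qform G v.
Proof.
rewrite /qform mulr_sumr -sumrB; apply: eq_bigr => i _; rewrite mulr_sumr -sumrB.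
by apply: eq_bigr => j _; rewrite !mxE; ring.
Qed.

(* Otherwise the n - 1 forms cutting out the line through b would have a common
   zero, which cannot be sent to a nonzero multiple of b. *)
Lemma qforms_surjective (k : closedFieldType) n (F : 'I_n -> 'M[k]_n) :
  (forall v, (forall l, qform (F l) v = 0) -> forall i, v i = 0) ->
  forall b : 'I_n -> k, exists v, forall l, qform (F l) v = b l.
Proof.
case: n F => [|n] F hF b; first by exists (fun _ => 0); case.
have [[l0 bl0]|hb] := pselect (exists l, b l != 0); last first.
  exists (fun _ => 0) => l; have -> : b l = 0.
    by apply/eqP; apply: contrapT => /negP bl; apply: hb; exists l.
  by rewrite /qform big1 // => i _; rewrite big1 // => j _; rewrite !mulr0.
pose G l := F (lift l0 l) - (b (lift l0 l) / b l0) *: F l0.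
have [v [j vj] hv] := common_zero G (ltnSn n).
have Fv l : qform (F l) v = b l / b l0 * qform (F l0) v.
  have [l1 ->|->] := unliftP l0 l; last by rewrite divff // mul1r.
  by apply/eqP; rewrite -subr_eq0 -qformB; apply/eqP/hv.
have q0 : qform (F l0) v != 0.
  apply: contraNneq vj => q0; apply/eqP/hF => l; by rewrite Fv q0 mulr0.
(* The values at [v] are proportional to [b]; scaling [v] by [a] multiplies them by [a ^+ 2], so a
   square root corrects the factor. *)
have /closed_rootP[a] : size ('X^2 - (b l0 / qform (F l0) v)%:P) != 1%N.
  by rewrite size_XnsubC.
rewrite /root !hornerE subr_eq0 => /eqP ha.
exists (fun i => a * v i) => l; rewrite qformZ ha (Fv l).
by field; rewrite bl0 q0.
Qed.

(** * Power series identities for the Hilbert series *)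

Section Convolution.
Implicit Types (P Q : {poly int}) (f g : nat -> int).

(** The coefficients of [P] times the power series with coefficients [f]; [conv_coef] reads them off
    from truncations. *)
Definition conv P f i : int := \sum_(j < i.+1) P`_j * f (i - j)%N.

Lemma conv_coef P f i N : (i <= N)%N -> conv P f i = (P * \poly_(j < N.+1) f j)`_i.
Proof.
move=> iN; rewrite coefM; apply: eq_bigr => j _; rewrite coef_poly ltnS.
by rewrite (leq_trans (leq_subr _ _) iN).
Qed.

Lemma convM P Q f : conv (P * Q) f =1 conv P (conv Q f).
Proof.
move=> i; rewrite (@conv_coef (P * Q) _ _ i) // -mulrA coefM; apply: eq_bigr => j _.
by rewrite (@conv_coef Q _ _ i) // leq_subr.
Qed.

Lemma eq_conv P f g : f =1 g -> conv P f =1 conv P g.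
Proof. by move=> fg i; apply: eq_bigr => j _; rewrite fg. Qed.

(** A factor with constant term 1 can be cancelled: the [i]-th coefficient determines [f i] from the
    earlier values. *)
Lemma conv_inj P f g : P`_0 = 1 -> conv P f =1 conv P g -> f =1 g.
Proof.
move=> P0 fg i; have [N] := ubnP i; elim: N i => // N IH i iN.
have := fg i; rewrite /conv !big_ord_recl P0 !mul1r !subn0.
rewrite (eq_bigr (fun j : 'I_i => P`_(lift ord0 j) * g (i - lift ord0 j)%N)).
  by move/addIr.
move=> j _; rewrite IH // lift0 (leq_trans _ (ltnSE iN)) // ltn_subrL /=.
exact: leq_ltn_trans (ltn_ord j).
Qed.

Lemma conv_1subXX_count_poly (u : nat -> nat) :
  conv (1 - 'X^2) (fun d => count_poly u d) =1 (fun d => u d).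
Proof.
move=> i; rewrite (@conv_coef _ _ _ i) // mulrBl mul1r coefB coefXnM !coef_poly ltnSn.
case: i => [|[|i]]; rewrite ?subr0 //=.
by rewrite subSS subn1 /= ltnS ltnW ?PoszD ?addrK // ltnS ltnW.
Qed.

Lemma conv_1addX (u : nat -> nat) :
  conv (1 + 'X) (fun d => u d) =1 (fun d => count_linear u d).
Proof.
move=> i; rewrite (@conv_coef _ _ _ i) // mulrDl mul1r coefD coefXM !coef_poly ltnSn.
by case: i => [|i] /=; rewrite ?addr0 // ltnS leqnSn PoszD.
Qed.

Lemma conv_iter_linear m (u : nat -> nat) :
  conv ((1 + 'X) ^+ m) (fun d => u d) =1 (fun d => iter m count_linear u d).
Proof.
elim: m => [|m IH] i /=.
  by rewrite expr0 (@conv_coef _ _ _ i) // mul1r coef_poly ltnSn.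
by rewrite exprS convM (eq_conv _ IH) conv_1addX.
Qed.

Lemma conv_iter_poly m (u : nat -> nat) :
  conv ((1 - 'X^2) ^+ m) (fun d => iter m count_poly u d) =1 (fun d => u d).
Proof.
elim: m => [|m IH] i /=.
  by rewrite expr0 (@conv_coef _ _ _ i) // mul1r coef_poly ltnSn.
by rewrite exprSr convM (eq_conv _ (conv_1subXX_count_poly _)) IH.
Qed.

(** The coefficient of [t^d] in [(1 + t)^n / (1 - t^2)^m]. *)
Definition clifford_count n m d : nat :=
  iter n count_linear (iter m count_poly (fun d => (d == 0)%N : nat)) d.

(** Since [(1 - t)(1 + t) = 1 - t^2], the series [(1 - t)^(-n)] equals [(1 + t)^n / (1 - t^2)^n]. *)
Lemma hilbert_count n (h : nat -> nat) :
  (forall i, \sum_(j < i.+1) ((1 - 'X) ^+ n : {poly int})`_j * (h (i - j)%N)%:Z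
     = (i == 0%N)%:R) ->
  forall d, h d = clifford_count n n d.
Proof.
move=> hh d; apply/eqP; rewrite -eqz_nat; apply/eqP.
apply: (@conv_inj ((1 - 'X) ^+ n) (fun d => h d) (fun d => clifford_count n n d)).
  by rewrite -horner_coef0 horner_exp !hornerE ?subr0 expr1n.
move=> i; rewrite [LHS]hh -(eq_conv _ (conv_iter_linear _ _)) -convM -exprMn.
have -> : (1 - 'X) * (1 + 'X) = 1 - 'X^2 :> {poly int} by rewrite -subr_sqr expr1n.
by rewrite conv_iter_poly; case: (i == 0%N).
Qed.

(** Multiplying the series for [m.+1] by [1 - t^2] gives the one for [m]. *)
Lemma clifford_count_drop n m d :
  (clifford_count n m.+1 d.+2 = clifford_count n m d.+2 + clifford_count n m.+1 d)%N.
Proof.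
have h : conv (1 - 'X^2) (fun d => clifford_count n m.+1 d) =1 (fun d => clifford_count n m d).
  move=> i; rewrite -(eq_conv _ (conv_iter_linear _ _)) -convM mulrC convM.
  by rewrite (eq_conv _ (conv_1subXX_count_poly _)) conv_iter_linear.
have := h d.+2; rewrite (@conv_coef _ _ _ d.+2) // mulrBl mul1r coefB coefXnM !coef_poly ltnSn /=.
rewrite subSS subn1 /= ltnS leqW ?leqnSn // => /eqP.
by rewrite subr_eq -PoszD eqz_nat => /eqP.
Qed.

End Convolution.

Lemma clifford_count0 n m : clifford_count n m 0 = 1%N.
Proof.
rewrite /clifford_count; elim: n => //=; elim: m => //.
Qed.

(** * Linear spans *)

Section LinearSpan.
Variables (k : fieldType) (V : lmodType k).

(** Given by its universal property, so that a linear condition on the span is checked on the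
    members of [s]. *)
Variant lspan (s : seq V) (v : V) : Prop :=
  LSpan of forall W : set V, linear_set W -> (forall u, u \in s -> W u) -> W v.

Lemma lspan_sub s v (W : set V) :
  lspan s v -> linear_set W -> (forall u, u \in s -> W u) -> W v.
Proof. by move=> [h]; apply: h. Qed.

Lemma lspan_lin s : linear_set (lspan s).
Proof.
split=> [|a u v [hu] [hv]]; first by split=> W [].
split=> W hW sW; have [_ WL] := hW.
by apply: WL; [apply: hu|apply: hv].
Qed.

Lemma mem_lspan s u : u \in s -> lspan s u.
Proof. by move=> us; split=> W _; apply. Qed.

Lemma lspan_trans s t v : (forall u, u \in s -> lspan t u) -> lspan s v -> lspan t v.
Proof. by move=> st sv; apply: (lspan_sub sv); first exact: lspan_lin. Qed.

Lemma lspan_codomP n (x : 'I_n -> V) v : lspan (codom x) v ->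
  exists c : 'I_n -> k, v = \sum_i c i *: x i.
Proof.
move=> vx; apply: (lspan_sub (W := [set v | exists c : 'I_n -> k, v = \sum_i c i *: x i]) vx).
  split; first by exists (fun _ => 0); rewrite big1 // => i _; rewrite scale0r.
  move=> a _ _ [b ->] [c ->]; exists (fun i => a * b i + c i).
  by rewrite scaler_sumr -big_split; apply: eq_bigr => i _; rewrite scalerDl scalerA.
move=> _ /codomP[i ->]; exists (fun j => (j == i)%:R).
by rewrite (bigD1 i) //= eqxx scale1r big1 ?addr0 // => j /negbTE ->; rewrite scale0r.
Qed.

Lemma lspan_sum_codom n (x : 'I_n -> V) (c : 'I_n -> k) :
  lspan (codom x) (\sum_i c i *: x i).
Proof.
apply: (linear_set_sum _ (lspan_lin _)) => i _.
exact: (linear_setZ _ (lspan_lin _) (mem_lspan (codom_f _ _))).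
Qed.

(** Steinitz exchange: as [c i] is nonzero, the combination can be solved for [x i]. *)
Lemma lspan_exchange n (x : 'I_n -> V) (c : 'I_n -> k) i j : c i != 0 ->
  lspan (\sum_l c l *: x l :: [seq x l | l <- rem i (enum 'I_n)]) (x j).
Proof.
move=> ci; set s := (_ :: _); have hs := lspan_lin s.
have rest l : l != i -> lspan s (x l).
  move=> li; apply: mem_lspan; rewrite inE; apply/orP; right.
  by apply: map_f; rewrite mem_rem_uniq ?enum_uniq // inE li mem_enum.
have [->|/rest //] := eqVneq j i.
have -> : x i = (c i)^-1 *: (\sum_l c l *: x l - \sum_(l | l != i) c l *: x l).
  by rewrite [X in X - _](bigD1 i) //= addrK scalerA mulVf // scale1r.
apply: (linear_setZ _ hs); apply: (linear_setD hs).
  by apply: mem_lspan; rewrite inE eqxx.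
apply: (linear_setN hs); apply: (linear_set_sum _ hs) => l li.
exact: (linear_setZ _ hs (rest _ li)).
Qed.

End LinearSpan.

Lemma size_rem_enum (U : Type) n (x : 'I_n -> U) i :
  size [seq x l | l <- rem i (enum 'I_n)] = n.-1.
Proof. by rewrite size_map size_rem ?mem_enum // size_enum_ord. Qed.

Lemma linear_maps_deg (k : fieldType) (A : algType k) (W : nat -> set A) e :
  linear_fam W -> linear_set [set z | maps_deg W z e].
Proof.
move=> hW; split=> [d v _|a y z hy hz d v Wv].
  by rewrite mul0r; case: (hW (e + d)%N).
rewrite mulrDl -scalerAl; case: (hW (e + d)%N) => _; apply; [exact: hy|exact: hz].
Qed.

Lemma linear_commute (k : fieldType) (A : algType k) (z : A) :
  linear_set [set u | u * z = z * u].
Proof.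
split=> [|a u v /= hu hv]; first by rewrite /= mul0r mulr0.
by rewrite mulrDl mulrDr -scalerAl -scalerAr hu hv.
Qed.

(** * Generators of a graded Clifford algebra *)

Section CliffordGenerators.
Variables (k : fieldType) (n : nat) (S : cgAlgebra k).

Lemma gr_linear : linear_fam (gr S).
Proof.
move=> d; have [W0 _ _] := gr_grading S; split=> [|a u v hu hv]; first exact: W0.
by apply: gradingD (gr_grading S) _ hv; apply: gr_scale.
Qed.

(** It states that the elements of [gr S d] are combinations of words of degree [d] in [X] and
    [Y]. *)
Definition clifford_ind (X Y : 'I_n -> S) : Prop := forall W : nat -> set S,
  linear_fam W -> W 0%N 1 ->
  (forall i d v, W d v -> W d.+1 (X i * v)) -> (forall i d v, W d v -> W d.+2 (Y i * v)) ->
  forall d s, gr S d s -> W d s.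

Definition clifford_gens (F : 'I_n -> 'M[k]_n) (X Y : 'I_n -> S) : Prop :=
  [/\ (forall i, gr S 1%N (X i)) /\ (forall i, gr S 2 (Y i)),
      forall i j, X i * X j + X j * X i = \sum_m F m i j *: Y m,
      forall i j, X i * Y j = Y j * X i,
      forall i j, Y i * Y j = Y j * Y i
    & clifford_ind X Y].

Lemma fmonom_consE (I : choiceType) (x : I) (l : seq I) :
  FMonom (x :: l) = monalg.mmul (fmu x) (FMonom l).
Proof. by apply: val_inj => /=; rewrite fmM fmuE. Qed.

Lemma free_alg_cons (x : 'I_n + 'I_n) l :
  << FMonom (x :: l) >> = << fmu x >> * << FMonom l >> :> free_alg k n.
Proof. by rewrite fmonom_consE [RHS]malgM_def fgmulUU mulr1. Qed.

Lemma is_clifford_gens : is_clifford n S -> exists F X Y, clifford_gens F X Y.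
Proof.
move=> [Ft [_ _ [phi [phiZ [psi phiK psiK] phigr]]]].
set G := clifford_rel Ft in phi phiZ psi phiK psiK phigr.
pose pi : free_alg k n -> quot_alg G := @quot_pi k (free_alg k n) G.
pose F m := tnth Ft m; pose X i := psi (pi (fx k i)); pose Y i := psi (pi (fy k i)).
have phi_inj : injective phi := can_inj phiK.
have piD a b : pi (a + b) = pi a + pi b by exact: quot_piD.
have piM a b : pi (a * b) = pi a * pi b by exact: quot_piM.
have piZ c a : pi (c *: a) = c *: pi a by exact: quot_piZ.
have pi0 : pi 0 = 0 by rewrite -[0 in LHS](scale0r 0) piZ scale0r.
have pi_sum (I : Type) (r : seq I) (f : I -> free_alg k n) :
    pi (\sum_(i <- r) f i) = \sum_(i <- r) pi (f i).
  by elim/big_rec2: _ => // i a b _ <-; rewrite piD.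
have rel a b : G (a - b) -> pi a = pi b.
  by move=> h; apply/quot_piE => J [_ GJ]; apply: GJ.
have phiX i : phi (X i) = pi (fx k i) by rewrite /X psiK.
have phiY i : phi (Y i) = pi (fy k i) by rewrite /Y psiK.
have phi_sum (f : 'I_n -> k) (s : 'I_n -> S) :
    phi (\sum_i f i *: s i) = \sum_i f i *: phi (s i).
  by rewrite rmorph_sum; apply: eq_bigr => i _; rewrite phiZ.
exists F, X, Y.
have word_gr (m : {fmonom ('I_n + 'I_n)%type}) : free_gr (word_deg m) (<< m >> : free_alg k n).
  by move=> m'; rewrite monalg.mcoeffU1; case: (eqVneq m m') => [->|]; rewrite ?eqxx.
split.
- split=> i; apply/phigr; rewrite ?phiX ?phiY.
    exists (fx k i) => //; rewrite (_ : 1%N = word_deg (fmu (inl i : 'I_n + 'I_n)%type)).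
      exact: word_gr.
    by rewrite /word_deg fmuE big_seq1.
  exists (fy k i) => //; rewrite (_ : 2%N = word_deg (fmu (inr i : 'I_n + 'I_n)%type)).
    exact: word_gr.
  by rewrite /word_deg fmuE big_seq1.
- move=> i j; apply: phi_inj; rewrite phi_sum rmorphD !rmorphM !phiX -!piM -piD.
  under eq_bigr do rewrite phiY -piZ.
  rewrite -pi_sum; apply: rel; exists i, j; exact: Or31.
- move=> i j; apply: phi_inj; rewrite !rmorphM !phiX !phiY -!piM.
  by apply: rel; exists i, j; exact: Or32.
- move=> i j; apply: phi_inj; rewrite !rmorphM !phiY -!piM.
  by apply: rel; exists i, j; exact: Or33.
move=> W hW W1 WX WY d s /phigr[g gd gE].
(* The homogeneous lift [g] of [phi s] to the free algebra involves only words of degree [d], so a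
   single word may be treated by induction on its length. *)
have -> : s = \sum_(m <- finmap.enum_fset (monalg.msupp g)) monalg.mcoeff m g *: psi (pi << m >>).
  apply: phi_inj; rewrite -gE rmorph_sum -/(pi g) {1}(monalgE g) pi_sum.
  apply: eq_bigr => m _; rewrite phiZ psiK -piZ; congr pi.
  by apply/malgP => m'; rewrite monalg.mcoeffZ !monalg.mcoeffU mulr_natr.
rewrite big_seq; apply: linear_set_sum => [|m mg]; first exact: hW.
apply: linear_setZ; first exact: hW.
have <- : word_deg m = d by apply: gd; rewrite monalg.mcoeff_neq0.
case: m {mg} => l; elim: l => [|x l IH].
  rewrite /word_deg big_nil (_ : psi _ = 1) //.
  apply: phi_inj; rewrite psiK rmorph1 (_ : << _ >> = 1 :> free_alg k n) //.
  by congr << _ >>; apply: val_inj; rewrite /= fm1.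
have -> : psi (pi << FMonom (x :: l) >>) = psi (pi << fmu x >>) * psi (pi << FMonom l >>).
  by apply: phi_inj; rewrite rmorphM !psiK -piM free_alg_cons.
rewrite /word_deg big_cons; case: x => i; [exact: WX|exact: WY].
Qed.

End CliffordGenerators.

(** * Normal forms compared with the Hilbert series of [S] *)

Section NormalForms.
Variables (k : fieldType) (n : nat) (S : cgAlgebra k).
Variables (F : 'I_n -> 'M[k]_n) (X Y : 'I_n -> S).
Hypotheses (two : (2%:R : k) != 0) (gens : clifford_gens F X Y).

Definition base_fam (d : nat) : set S := if d == 0%N then [set c%:A | c in [set: k]] else [set 0].

Lemma base_fam_lin : linear_fam base_fam.
Proof.
move=> [|d]; split=> /=.
- by exists 0; rewrite ?scale0r.
- move=> a _ _ [b _ <-] [c _ <-]; exists (a * b + c) => //.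
  by rewrite scalerDl scalerA.
- by [].
- by move=> a u v /= -> ->; rewrite scaler0 addr0.
Qed.

Lemma base_fam_covered : covered_fam base_fam (fun d => (d == 0%N) : nat).
Proof.
move=> [|d]; last by exists (fun _ => 0) => _ ->; exists (fun _ => 0); rewrite big_ord0.
by exists (fun _ => 1) => _ [c _ <-]; exists (fun _ => c); rewrite big_ord1.
Qed.

Definition normal_forms (xs ys : seq S) := adj_linears (adj_polys base_fam ys) xs.

Lemma normal_forms_lin xs ys : linear_fam (normal_forms xs ys).
Proof. exact/adj_linears_lin/adj_polys_lin/base_fam_lin. Qed.

Lemma normal_forms1 xs ys : normal_forms xs ys 0%N 1.
Proof.
apply: sub_adj_linears; first exact/adj_polys_lin/base_fam_lin.
apply: sub_adj_polys; first exact: base_fam_lin.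
by exists 1; rewrite ?scale1r.
Qed.

Lemma normal_forms_covered xs ys d :
  covered (normal_forms xs ys d) (clifford_count (size xs) (size ys) d).
Proof. exact/adj_linears_covered/adj_polys_covered/base_fam_covered. Qed.

Lemma lspanY_central y s : lspan (codom Y) y -> y * s = s * y.
Proof.
case: gens => _ _ XY YY ind yY.
have [_ _ gs] := gr_grading S.
have hom d v : gr S d v -> y * v = v * y.
  move=> hv; apply: (lspan_sub (W := [set u | u * v = v * u]) yY).
    exact: linear_commute.
  move=> _ /codomP[i ->] /=; move: d v hv.
  apply: (ind (fun _ => [set v | Y i * v = v * Y i])).
  - move=> d; split=> [|a u v /= hu hv]; first by rewrite /= mul0r mulr0.
    by rewrite mulrDl mulrDr -scalerAl -scalerAr hu hv.
  - by rewrite /= mul1r mulr1.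
  - by move=> j d v /= hv; rewrite mulrA -XY -!mulrA hv.
  - by move=> j d v /= hv; rewrite mulrA YY -!mulrA hv.
have [f [[fd [r [_ _ ->]]] _]] := gs s.
by rewrite mulr_sumr mulr_suml; apply: eq_bigr => d _; apply: hom (fd d).
Qed.

Lemma lspanX_anticomm a b : lspan (codom X) a -> lspan (codom X) b ->
  lspan (codom Y) (a * b + b * a).
Proof.
case: gens => _ XX _ _ _; move=> aX bX.
have hY := lspan_lin (codom Y).
have lin c : linear_set [set u | lspan (codom Y) (u * c + c * u)].
  split=> [|t u v /= hu hv]; first by rewrite /= mul0r mulr0 addr0; case: hY.
  rewrite mulrDl mulrDr -scalerAl -scalerAr addrACA -scalerDr.
  by case: hY => _; apply.
apply: (lspan_sub (W := [set u | lspan (codom Y) (u * b + b * u)]) aX (lin b)).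
move=> _ /codomP[i ->] /=; rewrite addrC.
apply: (lspan_sub (W := [set u | lspan (codom Y) (u * X i + X i * u)]) bX (lin _)).
by move=> _ /codomP[j ->] /=; rewrite XX; apply: lspan_sum_codom.
Qed.

Lemma lspanX_sqr a : lspan (codom X) a -> lspan (codom Y) (a * a).
Proof.
move=> aX; have -> : a * a = 2%:R^-1 *: (a * a + a * a).
  by rewrite -mulr2n -scaler_nat scalerA mulVf // scale1r.
exact: (linear_setZ _ (lspan_lin _) (lspanX_anticomm aX aX)).
Qed.

Section Maps.
Variables xs ys : seq S.
Hypothesis xsX : forall a, a \in xs -> lspan (codom X) a.
Hypothesis ysY : forall b, b \in ys -> lspan (codom Y) b.
Hypothesis Yys : forall i, lspan ys (Y i).

Lemma normal_forms_mapsY y : lspan (codom Y) y -> maps_deg (adj_polys base_fam ys) y 2.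
Proof.
move=> yY; have hL := adj_polys_lin ys base_fam_lin.
apply: (lspan_sub (W := [set z | maps_deg (adj_polys base_fam ys) z 2]) yY).
  exact: linear_maps_deg.
move=> _ /codomP[i ->]; apply: (lspan_sub (Yys i)); first exact: linear_maps_deg.
move=> u uys; apply: adj_polys_maps => //; first exact: base_fam_lin.
by move=> a b /ysY ha _; apply: lspanY_central.
Qed.

Lemma normal_forms_maps2 y : lspan (codom Y) y -> maps_deg (normal_forms xs ys) y 2.
Proof.
move=> yY; apply: adj_linears_maps_comm; first exact/adj_polys_lin/base_fam_lin.
  by move=> x _; apply: lspanY_central.
exact: normal_forms_mapsY.
Qed.

Lemma normal_forms_maps1 x : lspan xs x -> maps_deg (normal_forms xs ys) x 1.
Proof.
move=> xx; apply: (lspan_sub (W := [set z | maps_deg (normal_forms xs ys) z 1]) xx).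
  exact/linear_maps_deg/normal_forms_lin.
move=> a axs; apply: adj_linears_maps => //; first exact/adj_polys_lin/base_fam_lin.
  move=> b c /xsX bX /xsX cX; have h := lspanX_anticomm bX cX.
  by split=> [|d _]; [exact: normal_forms_mapsY|exact: lspanY_central].
move=> b /xsX bX; have h := lspanX_sqr bX.
by split=> [|d _]; [exact: normal_forms_mapsY|exact: lspanY_central].
Qed.

(** The normal forms contain 1 and are stable under left multiplication by the generators. The
    freedom in [xs] and [ys] serves to put a given linear form first, or to leave out a redundant
    [Y]. *)
Lemma gr_normal_forms d s : (forall i, lspan xs (X i)) ->
  gr S d s -> normal_forms xs ys d s.
Proof.
case: gens => _ _ _ _ ind Xxs; apply: ind.
- exact: normal_forms_lin.
- exact: normal_forms1.
- by move=> i e v; apply: normal_forms_maps1.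
- by move=> i e v; apply: normal_forms_maps2; apply/mem_lspan/codom_f.
Qed.

End Maps.

Variable h : nat -> nat.
Hypothesis hdim : forall d, has_dim (gr S d) (h d).
Hypothesis hcount : forall d, h d = clifford_count n n d.

Section Complement.
Variables (g : S) (rest : seq S).
Hypothesis sz : size rest = n.-1.
Hypothesis n0 : (0 < n)%N.
Hypothesis gX : lspan (codom X) g.
Hypothesis restX : forall a, a \in rest -> lspan (codom X) a.
Hypothesis Xg : forall i, lspan (g :: rest) (X i).

Let T := normal_forms rest (codom Y).

Let xsX a : a \in g :: rest -> lspan (codom X) a.
Proof. by rewrite inE => /predU1P[->|/restX]. Qed.

Let ysY b : b \in codom Y -> lspan (codom Y) b.
Proof. exact: mem_lspan. Qed.

Let Yys i : lspan (codom Y) (Y i).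
Proof. exact/mem_lspan/codom_f. Qed.

Lemma gr_complement d s : gr S d.+1 s -> exists a b, [/\ T d.+1 a, T d b & s = a + g * b].
Proof. exact: (gr_normal_forms xsX ysY Yys Xg). Qed.

Lemma gr_complement0 s : gr S 0 s -> T 0%N s.
Proof. exact: (gr_normal_forms xsX ysY Yys Xg). Qed.

(* The sum T + g T has as many generators as the Hilbert series allows. *)
Lemma complement_direct d a b : T d.+1 a -> T d b -> a + g * b = 0 -> a = 0 /\ b = 0.
Proof.
have [t1 ht1] := normal_forms_covered rest (codom Y) d.+1.
have [t0 ht0] := normal_forms_covered rest (codom Y) d.
have sY : size (codom Y) = n by rewrite size_codom card_ord.
have hd : h d.+1 = (clifford_count (size rest) (size (codom Y)) d.+1 +
    clifford_count (size rest) (size (codom Y)) d)%N.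
  by rewrite hcount sY sz /clifford_count -{1}(prednK n0).
have spanned : spanned_by (cat_family t1 (fun i => g * t0 i)) (gr S d.+1).
  by move=> s /gr_complement; apply: spanned_cat.
have dim := hdim d.+1; rewrite hd in dim.
have free := has_dim_spanned_free dim spanned.
move=> /ht1[c1 ->] /ht0[c0 ->] e.
have : \sum_i cat_family c1 c0 i *: cat_family t1 (fun i => g * t0 i) i = 0.
  rewrite sum_cat_family -[RHS]e mulr_sumr; congr (_ + _).
  by apply: eq_bigr => i _; rewrite scalerAr.
move=> /free cf; split; apply: big1 => i _.
  have := cf (lshift _ i); rewrite /cat_family.
  by rewrite (unsplitK (inl _ i)) => ->; rewrite scale0r.
have := cf (rshift _ i); rewrite /cat_family.
by rewrite (unsplitK (inr _ i)) => ->; rewrite scale0r.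
Qed.

(** For a homogeneous [s = a + g * b] with [a] and [b] in [T], the product [g * s] is [g * a]
    because [g * g = 0], and directness of [T + g T] forces [a = 0]. *)
Lemma annihilator_sqr0 s : g * g = 0 -> g * s = 0 -> exists b, s = g * b.
Proof.
move=> gg gs; have g1 : gr S 1%N g.
  case: gens => [[X1 _] _ _ _ _]; apply: (lspan_sub gX); first exact: gr_linear.
  by move=> _ /codomP[i ->].
have [W0 _ gru] := gr_grading S.
have T0 d : T d 0 by case: (normal_forms_lin rest (codom Y) d).
have hom d v : gr S d v -> g * v = 0 -> exists b, v = g * b.
  case: d => [/gr_complement0 Tv gv|d /gr_complement[a [b [Ta Tb ->]]]].
    have [_ ->] := complement_direct (T0 1%N) Tv (etrans (add0r _) gv).
    by exists 0; rewrite mulr0.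
  rewrite mulrDr mulrA gg mul0r addr0 => ga; exists b.
  have [_ ->] := complement_direct (T0 d.+2) Ta (etrans (add0r _) ga).
  by rewrite add0r.
have [f [[fd [r [ur f0 sE]]] _]] := gru s.
have gf d : g * f d = 0.
  (* The homogeneous components of [g * s], shifted by the degree of [g]; they vanish by uniqueness,
     as [g * s = 0]. *)
  pose f' d := if d is d'.+1 then g * f d' else 0.
  have zero : is_fin_sum (fun _ : nat => 0 : S) (g * s).
    by exists [::]; rewrite big_nil gs.
  have e : f' = (fun _ => 0).
    have gf' i : gr S i (f' i) by case: i => [|i]; [exact: W0|exact: gr_mul g1 (fd i)].
    apply: (grading_uniq (gr_grading S) gf' _ W0 zero).
    exists (map succn r); split.
    - by rewrite map_inj_uniq // => i j [].
    - move=> [|i] //= hi; rewrite f0 ?mulr0 //.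
      by apply: contra hi => ir; apply: map_f.
    - by rewrite big_map sE mulr_sumr.
  by have := congr1 (fun u => u d.+1) e.
have /choice[b hb] : forall d, exists b, f d = g * b.
  by move=> d; apply: hom (fd d) (gf d).
exists (\sum_(i <- r) b i); rewrite sE mulr_sumr.
by apply: eq_bigr => i _; apply: hb.
Qed.

End Complement.

Lemma codomX_rest i a : a \in [seq X l | l <- rem i (enum 'I_n)] -> lspan (codom X) a.
Proof. by move=> /mapP[j _ ->]; apply/mem_lspan/codom_f. Qed.

Lemma annihilator_linear_form (v : 'I_n -> k) j s : v j != 0 ->
  let g := \sum_i v i *: X i in g * g = 0 -> g * s = 0 -> exists b, s = g * b.
Proof.
move=> vj g; apply: (annihilator_sqr0 (size_rem_enum X j)).
- exact: leq_ltn_trans (ltn_ord j).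
- exact: lspan_sum_codom.
- exact: codomX_rest.
- by move=> i; apply: lspan_exchange.
Qed.

(** With [X i] as the distinguished linear form, [X i * w i] lies in the second summand of the
    direct sum and the other terms lie in the first. *)
Lemma lspanY_X_free (w : 'I_n -> S) : (forall i, lspan (codom Y) (w i)) ->
  \sum_i w i * X i = 0 -> forall i, w i = 0.
Proof.
move=> wY w0 i; have i0 : (0 < n)%N := leq_ltn_trans (leq0n i) (ltn_ord i).
pose rest := [seq X l | l <- rem i (enum 'I_n)].
have ysY b : b \in codom Y -> lspan (codom Y) b by exact: mem_lspan.
have Yys j : lspan (codom Y) (Y j) by exact/mem_lspan/codom_f.
have T1 x : lspan rest x -> maps_deg (normal_forms rest (codom Y)) x 1.
  by apply: normal_forms_maps1 => // a; apply: codomX_rest.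
have T2 y : lspan (codom Y) y -> maps_deg (normal_forms rest (codom Y)) y 2.
  exact: normal_forms_maps2.
have one := normal_forms1 rest (codom Y).
have Xrest : forall j, lspan (X i :: rest) (X j).
  move=> j; have -> : X i = \sum_l (l == i)%:R *: X l.
    rewrite (bigD1 i) //= eqxx scale1r big1 ?addr0 // => l /negbTE ->.
    by rewrite scale0r.
  by apply: (@lspan_exchange _ _ _ _ (fun l => (l == i)%:R)); rewrite eqxx oner_neq0.
have Ta : normal_forms rest (codom Y) 3 (\sum_(j | j != i) w j * X j).
  apply: linear_set_sum => [|j ji]; first exact: normal_forms_lin.
  apply: (T2 _ (wY j) 1%N); rewrite -[X j]mulr1; apply: (T1 _ _ 0%N) => //.
  by apply/mem_lspan/map_f; rewrite mem_rem_uniq ?enum_uniq // inE ji mem_enum.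
have Tb : normal_forms rest (codom Y) 2 (w i).
  by rewrite -[w i]mulr1; apply: (T2 _ (wY i) 0%N).
have e : \sum_(j | j != i) w j * X j + X i * w i = 0.
  by rewrite -[RHS]w0 [RHS](bigD1 i) //= addrC (lspanY_central _ (wY i)).
by have [] := complement_direct (size_rem_enum X i) i0
  (mem_lspan (codom_f X i)) (@codomX_rest i) Xrest Ta Tb e.
Qed.

(** A relation makes some [Y i] redundant. The normal forms in the other [Y] then cover degree 2
    with one element too few, by [clifford_count_drop]. *)
Lemma Y_free : lin_indep Y.
Proof.
move=> c c0 i; apply/eqP; apply: contrapT => /negP ci.
have i0 : (0 < n)%N := leq_ltn_trans (leq0n i) (ltn_ord i).
pose ys := [seq Y l | l <- rem i (enum 'I_n)].
have Yys j : lspan ys (Y j).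
  apply: lspan_trans (lspan_exchange Y j ci) => u; rewrite c0 inE.
  by move=> /predU1P[->|]; [case: (lspan_lin ys)|exact: mem_lspan].
have ysY b : b \in ys -> lspan (codom Y) b.
  by move=> /mapP[j _ ->]; apply/mem_lspan/codom_f.
have sub v : gr S 2 v -> normal_forms (codom X) ys 2 v.
  apply: gr_normal_forms => // [a|j]; first exact: mem_lspan.
  exact/mem_lspan/codom_f.
have [e [efree eW _]] := has_dim_lin_indep (hdim 2).
have := lin_indep_leq efree (fun j => sub _ (eW j)) (normal_forms_covered (codom X) ys 2).
rewrite size_codom card_ord size_rem_enum hcount -{2}(prednK i0).
by rewrite clifford_count_drop clifford_count0 addn1 ltnn.
Qed.

End NormalForms.

(** * Infinite projective dimension from a square-zero element *)

Section InfiniteProjectiveDimension.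
Variables (R : pzRingType) (g : R).
Hypotheses (gg : g * g = 0) (ann : forall s, s * g = 0 -> exists b, s = b * g).
Hypothesis not_unit : forall a b, 1 + a * g + g * b != 0.

Definition ann_pred : {pred R^o} := fun v => v * g == 0.

Lemma ann_pred_submod : submod_closed ann_pred.
Proof.
split=> [|a u v]; rewrite /ann_pred /in_mem /=; first by rewrite mul0r.
by move=> /eqP hu /eqP hv; rewrite mulrDl -[a *: u]/(a * u) -mulrA hu hv mulr0 addr0.
Qed.

HB.instance Definition _ := GRing.isSubmodClosed.Build R R^o ann_pred ann_pred_submod.

(** By [gg] and [ann] this is the left ideal [R g]; multiplication by [g] maps [R] onto it with the
    same ideal as kernel, whence the periodic resolution. *)
Definition ann_mod : Type := {v : R^o | v \in ann_pred}.

HB.instance Definition _ := SubChoice.on ann_mod.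
HB.instance Definition _ := [SubChoice_isSubLmodule of ann_mod by <:].

Lemma ann_modP (v : ann_mod) : val v * g = 0.
Proof. exact/eqP/(valP v). Qed.

Definition to_ann (v : R) (hv : v * g = 0) : ann_mod := Sub (v : R^o) (introT eqP hv).

Lemma mulg_ann (v : R) : v * g * g = 0.
Proof. by rewrite -mulrA gg mulr0. Qed.

Definition mulg_map (v : R^o) : ann_mod := to_ann (mulg_ann v).

Lemma mulg_map_linear : linear mulg_map.
Proof. by move=> a u v; apply: val_inj; rewrite [LHS]mulrDl -mulrA. Qed.

HB.instance Definition _ := GRing.isLinear.Build R R^o ann_mod *:%R mulg_map mulg_map_linear.

Lemma mulg_map_surj : surj mulg_map.
Proof.
move=> y; have [b hb] := ann (ann_modP y).
by exists b; apply: val_inj.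
Qed.

(** [f] takes its values in [ann_mod] and is lifted through the surjection [mulg_map]. *)
Lemma lift_ann (P : lmodType R) (f : P -> R) : projective P ->
  (forall a u v, f (a *: u + v) = a * f u + f v) -> (forall x, f x * g = 0) ->
  exists h : {linear P -> R^o}, forall x, h x * g = f x.
Proof.
move=> Pproj flin fg; pose f' x := to_ann (fg x).
have f'lin : linear f' by move=> a u v; apply: val_inj; rewrite /= flin.
pose F' := GRing.isLinear.Build R P ann_mod *:%R f' f'lin.
pose F : {linear P -> ann_mod} := HB.pack f' F'.
have [h hh] := Pproj _ _ mulg_map F mulg_map_surj.
by exists h => x; have := congr1 val (hh x).
Qed.

(* Comparing a projective resolution with the periodic complex
   ... -> R -> R -> R of multiplications by g, in both directions, the identity
   of R survives in every degree modulo the image and the kernel of g. *)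
Lemma gldim_infinite N : ~ gldim_le R N.
Proof.
move=> /(_ ann_mod)[P [d [e [Pproj P0 esurj ex0 exS]]]].
(* [p] is the image of 1 under a comparison map from the periodic complex, and [h] belongs to one
   back to it; [a] and [b] measure how far the composite is from the identity. In degree [N.+1] the
   resolution vanishes, so [h p = 0], against [not_unit]. *)
suff inv i : exists (p : P i) (h : {linear P i -> R^o}) a b,
    [/\ exists p', d i p' = g *: p, forall x, h (d i x) * g = 0
      & h p = 1 + a * g + g * b].
  have [p [h [a [b [_ _]]]]] := inv N.+1.
  rewrite (P0 _ _ p) // linear0 => /esym/eqP; apply/negP; exact: not_unit.
elim: i => [|i [p [h [a [b [[p' dp'] hd hp]]]]]].
  have [p ep] := esurj (to_ann gg).
  have [|x|h hh] := @lift_ann (P 0%N) (fun x => val (e x)) (Pproj 0%N).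
  - by move=> a u v; rewrite linearP.
  - exact: ann_modP.
  have hpg : (h p - 1) * g = 0 by rewrite mulrBl hh ep /= mul1r subrr.
  have [b hb] := ann hpg.
  exists p, h, b, 0; split.
  - by apply/ex0; rewrite linearZ ep; apply: val_inj; rewrite /= -[RHS]gg.
  - by move=> x; rewrite hh (proj2 (ex0 _)) //; exists x.
  - by rewrite mulr0 addr0 -hb addrC subrK.
have [||h' hh'] := @lift_ann (P i.+1) (fun x => h (d i x)) (Pproj i.+1).
- by move=> c u v; rewrite !linearP.
- exact: hd.
(* By [g * g = 0], [h' p' * g = g * h p = g + g * a * g]: the error [a] passes from the left of [g]
   to its right, and [ann] supplies the new left one. *)
have hpg : (h' p' - 1 - g * a) * g = 0.
  have -> : (h' p' - 1 - g * a) * g = h' p' * g - g * (1 + a * g).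
    by rewrite !mulrBl mul1r mulrDr mulr1 opprD addrA mulrA.
  have e1 : h (d i p') = g * h p by rewrite dp' linearZ.
  by rewrite hh' e1 hp [g * (_ + g * b)]mulrDr (mulrA g g b) gg mul0r addr0 subrr.
have [c hc] := ann hpg.
exists p', h', c, a; split.
- by apply/exS; rewrite linearZ dp' /= scalerA gg scale0r.
- by move=> x; rewrite hh' (proj2 (exS _ _)) ?linear0 //; exists x.
- by rewrite -hc -addrA subrK addrC subrK.
Qed.

End InfiniteProjectiveDimension.

(** Products are reversed in [S^c], over which right [S]-modules are left modules. The element
    [1 + a * g + g * b] has augmentation 1 since [g] has positive degree, so it is nonzero. *)
Lemma gldim_infinite_graded (k : fieldType) (S : cgAlgebra k) (g : S) N :
  gr S 1%N g -> g * g = 0 -> (forall s, g * s = 0 -> exists b, s = g * b) ->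
  ~ right_gldim S N.
Proof.
move=> g1 gg ann [hN _]; apply: (gldim_infinite (g := (g : S^c)) gg ann _ hN) => a b.
apply/eqP => /(congr1 (@aug k S)).
have augMc (x y : S^c) : @aug k S (x * y) = @aug k S x * @aug k S y.
  by rewrite [LHS](@augM k S y x) mulrC.
have g0 : aug g = 0 by exact: aug_pos g1.
rewrite [LHS](@augD k S) [X in X + _](@augD k S) aug1 !augMc g0.
rewrite mulr0 mul0r !addr0 => /eqP; apply/negP.
rewrite (@augE _ _ _ 0) ?oner_neq0 //.
have [W0 _ _] := gr_grading S.
by exists (fun _ => 0); split; rewrite ?scale0r //; exists [::]; rewrite big_nil.
Qed.

(** * The centre in degree two *)

Section Centre.
Variables (k : closedFieldType) (n : nat) (S : cgAlgebra k).
Variables (F : 'I_n -> 'M[k]_n) (X Y : 'I_n -> S).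
Hypotheses (two : (2%:R : k) != 0) (qpa : quantum_polynomial S n) (gens : clifford_gens F X Y).

Lemma gens_anticomm i j : X i * X j + X j * X i = \sum_m F m i j *: Y m.
Proof. by case: gens. Qed.

Lemma gens_dims : exists2 h : nat -> nat, forall d, has_dim (gr S d) (h d)
  & forall d, h d = clifford_count n n d.
Proof. by case: qpa => _ _ _ [h [hdim /hilbert_count hh]]; exists h. Qed.

Definition quad_forms : set S := [set z | exists (C : 'I_n -> 'I_n -> k) (b : 'I_n -> k),
  z = \sum_i \sum_j C i j *: (X i * X j) + \sum_m b m *: Y m].

Lemma quad_forms_lin : linear_set quad_forms.
Proof.
split=> [|a _ _ [C [b ->]] [D [c ->]]].
  exists (fun _ _ => 0), (fun _ => 0).
  by rewrite !big1 ?addr0 // => i _; rewrite ?scale0r // big1 // => j _; rewrite scale0r.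
exists (fun i j => a * C i j + D i j), (fun m => a * b m + c m).
rewrite scalerDr addrACA !scaler_sumr; congr (_ + _).
  rewrite -big_split; apply: eq_bigr => i _.
  rewrite scaler_sumr -big_split; apply: eq_bigr => j _.
  by rewrite scalerDl scalerA.
by rewrite -big_split; apply: eq_bigr => i _; rewrite scalerDl scalerA.
Qed.

(** A family fed to [clifford_ind] to describe degrees up to 2; above that it imposes no
    condition. *)
Definition low_degree (d : nat) : set S := match d with
  | 0%N => [set c%:A | c in [set: k]] | 1%N => lspan (codom X) | 2%N => quad_forms | _ => setT end.

Lemma gr_low_degree d s : gr S d s -> low_degree d s.
Proof.
case: gens => _ _ _ _; apply.
- move=> [|[|[|e]]] //=; [exact: (base_fam_lin S 0)|exact: lspan_lin|exact: quad_forms_lin].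
- by exists 1; rewrite ?scale1r.
- move=> i [|[|e]] //= v; first move=> [c _ <-].
    rewrite mulr_algr; exact: (linear_setZ _ (lspan_lin _) (mem_lspan (codom_f X i))).
  move=> /lspan_codomP[c ->]; exists (fun a b => (a == i)%:R * c b), (fun _ => 0).
  rewrite [X in _ + X]big1 ?addr0 => [|m _]; last by rewrite scale0r.
  rewrite mulr_sumr [RHS](bigD1 i) //= [X in _ + X]big1 ?addr0 => [|a /negbTE ai].
    by apply: eq_bigr => j _; rewrite eqxx mul1r scalerAr.
  by rewrite big1 // => j _; rewrite ai mul0r scale0r.
- move=> i [|e] //= v [c _ <-]; rewrite mulr_algr.
  exists (fun _ _ => 0), (fun m => c * (m == i)%:R).
  rewrite [X in X + _]big1 ?add0r => [|a _]; last first.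
    by rewrite big1 // => j _; rewrite scale0r.
  rewrite (bigD1 i) //= eqxx mulr1 big1 ?addr0 // => m /negbTE ->.
  by rewrite mulr0 scale0r.
Qed.

Lemma gr1_linear_form g : gr S 1%N g -> exists v : 'I_n -> k, g = \sum_i v i *: X i.
Proof. by move=> /gr_low_degree/lspan_codomP. Qed.

(** By symmetry of [C], twice the sum is a combination of anticommutators. *)
Lemma sum_anticomm (C : 'I_n -> 'I_n -> k) :
  (forall i j, C i j = C j i) ->
  \sum_i \sum_j C i j *: (X i * X j) =
  \sum_m (2%:R^-1 * \sum_i \sum_j F m i j * C i j) *: Y m.
Proof.
move=> Csym; set s := LHS.
have e : s + s = \sum_m (\sum_i \sum_j F m i j * C i j) *: Y m.
  rewrite {2}/s exchange_big -big_split /=.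
  transitivity (\sum_i \sum_m (\sum_j F m i j * C i j) *: Y m); last first.
    by rewrite exchange_big; apply: eq_bigr => m _; rewrite -scaler_suml.
  apply: eq_bigr => i _; rewrite -big_split /=.
  transitivity (\sum_j \sum_m (F m i j * C i j) *: Y m); last first.
    by rewrite exchange_big; apply: eq_bigr => m _; rewrite -scaler_suml.
  apply: eq_bigr => j _; rewrite (Csym j i) -scalerDr gens_anticomm scaler_sumr.
  by apply: eq_bigr => m _; rewrite scalerA mulrC.
have -> : s = 2%:R^-1 *: (s + s) by rewrite -mulr2n -scaler_nat scalerA mulVf // scale1r.
by rewrite e scaler_sumr; apply: eq_bigr => m _; rewrite scalerA.
Qed.

Lemma linear_form_sqr (v : 'I_n -> k) :
  (\sum_i v i *: X i) * (\sum_i v i *: X i) = \sum_m (2%:R^-1 * qform (F m) v) *: Y m.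
Proof.
rewrite -(sum_anticomm (C := fun i j => v i * v j)) => [|i j]; last by rewrite mulrC.
rewrite mulr_suml; apply: eq_bigr => i _; rewrite mulr_sumr; apply: eq_bigr => j _.
by rewrite -scalerAl -scalerAr scalerA.
Qed.

Lemma base_point_free (v : 'I_n -> k) : (forall m, qform (F m) v = 0) -> forall i, v i = 0.
Proof.
move=> hv i; apply/eqP; apply: contrapT => /negP vi.
have [h hdim hcount] := gens_dims; have [_ gl _ _] := qpa.
have gg : (\sum_i v i *: X i) * (\sum_i v i *: X i) = 0.
  by rewrite linear_form_sqr big1 // => m _; rewrite hv mulr0 scale0r.
apply: (gldim_infinite_graded _ gg _ gl).
  case: gens => [[X1 _] _ _ _ _]; apply: linear_set_sum => [|j _]; first exact: gr_linear.
  exact: gr_scale.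
by move=> s; apply: (annihilator_linear_form two gens hdim hcount vi).
Qed.

(** Inserting [X i * X l * X j] turns the commutator into two terms with an anticommutator as
    factor, and anticommutators are central. *)
Lemma triple_product i j l : X i * X j * X l - X l * (X i * X j) =
  (\sum_m F m j l *: Y m) * X i - (\sum_m F m i l *: Y m) * X j.
Proof.
have c := lspanY_central gens (X i) (lspan_sum_codom Y (fun m => F m j l)).
by rewrite c -!gens_anticomm mulrDr mulrDl !mulrA opprD addrA addrK.
Qed.

Lemma centre2_lspanY z : centre2 z -> lspan (codom Y) z.
Proof.
move=> [/gr_low_degree[C [b zE]] zc]; have [h hdim hcount] := gens_dims.
pose A j l : S := \sum_m F m j l *: Y m.
have AY j l : lspan (codom Y) (A j l) by exact: lspan_sum_codom.
(* For fixed [i], the vector with entries [C i j - C j i] is shown to be a common zero of the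
   forms. *)
have K0 i j : C i j - C j i = 0.
  move: j; apply: base_point_free => m.
  suff K l : \sum_j F m j l * (C i j - C j i) = 0.
    rewrite /qform exchange_big big1 //= => l _.
    transitivity ((\sum_j F m j l * (C i j - C j i)) * (C i l - C l i)).
      by rewrite mulr_suml; apply: eq_bigr => j _; rewrite mulrA.
    by rewrite K mul0r.
  (* [w i] is the coefficient of [X i] in the commutator of [z] with [X l]. It vanishes by
     [lspanY_X_free], and then [Y_free] gives the claim for every [m]. *)
  pose w i := \sum_j (C i j - C j i) *: A j l.
  have w0 : \sum_i w i * X i = 0.
    have := zc (X l); rewrite zE mulrDl mulrDr.
    rewrite (lspanY_central gens (X l) (lspan_sum_codom Y b)) => /addIr/eqP.
    rewrite -subr_eq0 => /eqP zX.
    transitivity (\sum_i \sum_j C i j *: (A j l * X i - A i l * X j)).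
      under [RHS]eq_bigr do under eq_bigr do rewrite scalerBr.
      under [RHS]eq_bigr do rewrite sumrB.
      rewrite sumrB [X in _ - X]exchange_big -sumrB; apply: eq_bigr => a _.
      rewrite -sumrB mulr_suml; apply: eq_bigr => c _.
      by rewrite -scalerAl -scalerBl.
    rewrite -[RHS]zX mulr_suml mulr_sumr -sumrB; apply: eq_bigr => a _.
    rewrite mulr_suml mulr_sumr -sumrB; apply: eq_bigr => c _.
    by rewrite -scalerAl -scalerAr -scalerBr triple_product.
  have wi : w i = 0.
    apply: (lspanY_X_free two gens hdim hcount _ w0) => a.
    apply: linear_set_sum => [|j _]; first exact: lspan_lin.
    exact: (linear_setZ _ (lspan_lin _)).
  apply: (Y_free two gens hdim hcount (c := fun m => \sum_j F m j l * (C i j - C j i))).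
  rewrite -[RHS]wi /w; under [RHS]eq_bigr do rewrite scaler_sumr.
  rewrite exchange_big; apply: eq_bigr => p _; rewrite scaler_suml.
  by apply: eq_bigr => j _; rewrite scalerA mulrC.
rewrite zE sum_anticomm => [|i j]; last by apply/eqP; rewrite -subr_eq0 K0.
by apply: linear_setD; [exact: lspan_lin|exact: lspan_sum_codom|exact: lspan_sum_codom].
Qed.

Lemma centre2_squares : @centre2 k S = [set g ^+ 2 | g in gr S 1%N].
Proof.
have [[X1 Y2] _ _ _ _] := gens.
apply/seteqP; split=> [z|_ [g g1 <-]].
  move=> /centre2_lspanY/lspan_codomP[b zE].
  (* The factor 2 offsets the [2%:R^-1] in [linear_form_sqr]. *)
  have [v hv] := qforms_surjective base_point_free (fun m => 2%:R * b m).
  exists (\sum_i v i *: X i).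
    apply: linear_set_sum => [|j _]; first exact: gr_linear.
    exact: gr_scale.
  rewrite expr2 linear_form_sqr zE; apply: eq_bigr => m _.
  by rewrite hv mulrA mulVf // mul1r.
split=> [|s]; first by rewrite expr2; apply: (gr_mul g1 g1).
have [v ->] := gr1_linear_form g1; rewrite expr2 linear_form_sqr.
exact: (lspanY_central gens _ (lspan_sum_codom Y _)).
Qed.

End Centre.

Theorem theorem4p14 (k : closedFieldType) (char0 : [pchar k] =i pred0) (n : nat) :
  (forall S : cgAlgebra k, clifford_qpa n S ->
     @centre2 k S = [set g ^+ 2 | g in gr S 1%N]) /\
  (forall (r : nat) (A : cgAlgebra k), clifford_qci n r A ->
     exists (S : cgAlgebra k) (g : 'I_r -> S),
       [/\ clifford_qpa n S, forall i, gr S 1%N (g i)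
         & gr_iso_quot A (gr S) (range (fun i => g i ^+ 2))]).
Proof.
have two : (2%:R : k) != 0 by rewrite (proj1 (pcharf0P k) char0).
have centre S : clifford_qpa n S -> @centre2 k S = [set g ^+ 2 | g in gr S 1%N].
  by move=> [qpa /is_clifford_gens[F [X [Y gens]]]]; apply: centre2_squares gens.
split=> // r A [S [f [qpa fc _ fA]]].
have /choice[g hg] : forall i, exists g, gr S 1%N g /\ g ^+ 2 = f i.
  by move=> i; have := fc i; rewrite centre // => -[g g1 gE]; exists g.
exists S, g; split=> // [i|]; first by case: (hg i).
rewrite (_ : (fun i => _) = f) //; apply: funext => i; by case: (hg i).
Qed.
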